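(* For $\alpha>-1$ and $m\in\mathbb{Z}_+$ let $$\psi^{\alpha}_{2m}(x)=\frac{2^{(2\alpha+1)/4}}{\sqrt{g_m^{(\alpha,-\frac12)}}}\,\frac{1}{\cosh^{1+\alpha}x}\,P_m^{(\alpha,-\frac12)}\!\left(1-\frac{2}{\cosh^2x}\right),$$ $$\psi^{\alpha}_{2m+1}(x)=-\frac{2^{(2\alpha+3)/4}}{\sqrt{g_m^{(\alpha,\frac12)}}}\,\frac{\sinh x}{\cosh^{2+\alpha}x}\,P_m^{(\alpha,\frac12)}\!\left(1-\frac{2}{\cosh^2x}\right),\qquad x\in\mathbb{R}.$$ Then all systems $\{\varphi_m\}_{m\in\mathbb{Z}_+}$ of half-range form (defined in the context) which are orthonormal in $L_2(\mathbb{R})$ and possess a tridiagonal, skew-symmetric (irreducible) differentiation matrix are, up to a linear change of variables (and a global sign), exactly the systems $\{\psi^\alpha_m\}_{m\in\mathbb{Z}_+}$ for any $\alpha>-1$. That is: (i) if $\{\varphi_m\}_{m\in\mathbb{Z}_+}$ is such a system, then there exist $\alpha>-1$, $a>0$ and $\epsilon\in\{-1,1\}$ such that $\varphi_m(x)=\epsilon\sqrt a\,\psi^\alpha_m(ax)$ for all $m\in\mathbb{Z}_+$ and $x\in\mathbb{R}$; (ii) for every $\alpha>-1$ the system $\{\psi_m^\alpha\}_{m\in\mathbb{Z}_+}$ is such a system.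
   Context: $\mathbb{Z}_+=\{0,1,2,\ldots\}$. All functions are real-valued. $P_m^{(\alpha,\beta)}$ is the $m$th Jacobi polynomial in the standard normalisation, and $g_m^{(\alpha,\beta)}=\int_{-1}^1(1-t)^\alpha(1+t)^\beta[P_m^{(\alpha,\beta)}(t)]^2\,dt$. Tridiagonal, skew-symmetric, irreducible differentiation matrix: the functions $\varphi_m$ are differentiable on $\mathbb{R}$ and there are real numbers $b_m>0$, $m\in\mathbb{Z}_+$ (positivity being the paper's normalisation), such that, with $b_{-1}=0$, $$\varphi_m'=-b_{m-1}\varphi_{m-1}+b_m\varphi_{m+1},\qquad m\in\mathbb{Z}_+ .$$ Half-range form: there exist - absolutely continuous measures $w_E(t)\,dt$ and $w_O(t)\,dt$ on $(-1,1)$ ($w_E,w_O\ge0$) with orthonormal polynomials $\{r_m\}_{m\in\mathbb{Z}_+}$ and $\{s_m\}_{m\in\mathbb{Z}_+}$ respectively ($r_m,s_m$ real polynomials of degree exactly $m$, leading coefficients of either sign, $\int_{-1}^1 r_mr_nw_E\,dt=\delta_{m,n}$, $\int_{-1}^1 s_ms_nw_O\,dt=\delta_{m,n}$); - a function $h:(-1,1)\to(0,\infty)$ mapping onto $(0,\infty)$, differentiable, with $h'$ measurable and $h'(t)>0$ for all $t\in(-1,1)$; its inverse is $H:(0,\infty)\to(-1,1)$, differentiable with $h'(t)H'(h(t))=1$; $H$ is extended to $\mathbb{R}$ as an even function, $H(-x)=H(x)$, with $H(0)=-1$; - functions $\theta_E,\theta_O:(-1,1)\to\mathbb{R}$ such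 that $t\mapsto\theta_E(t)\sqrt{w_E(t)/h'(t)}$ and $t\mapsto\theta_O(t)\sqrt{w_O(t)/h'(t)}$ belong to $L_\infty(-1,1)$; - an even function $\Theta_E$ and an odd function $\Theta_O$ on $\mathbb{R}$ with $\Theta_E(x)=\theta_E(H(x))H'(x)w_E(H(x))$ and $\Theta_O(x)=\theta_O(H(x))H'(x)w_O(H(x))$ for $x\in(0,\infty)$, and $\Theta_E(0)\neq0$; such that $$\varphi_{2m}(x)=\Theta_E(x)\,r_m(H(x)),\qquad \varphi_{2m+1}(x)=\Theta_O(x)\,s_m(H(x)),\qquad m\in\mathbb{Z}_+,\ x\in\mathbb{R}.$$ In particular $\varphi_m$ is even for even $m$ and odd for odd $m$. *)

(* Defs.v *)
From HB Require Import structures.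
From mathcomp Require Import all_boot all_order all_algebra.
From mathcomp Require Import all_classical all_reals all_analysis.

Set Implicit Arguments.
Unset Strict Implicit.
Unset Printing Implicit Defensive.

Import Order.TTheory GRing.Theory Num.Theory.
Import numFieldNormedType.Exports.

Local Open Scope classical_set_scope.
Local Open Scope ring_scope.

Section Definitions.
Context {R : realType}.
Implicit Types (al be x t : R) (m n k : nat).

Local Notation mu := (@lebesgue_measure R).
Local Notation Iab := (`]-1, 1[%classic : set R).

Definition cosh x : R := (expR x + expR (- x)) / 2.
Definition sinh x : R := (expR x - expR (- x)) / 2.

(* binomial coefficient with a real upper entry: a (a-1) ... (a-k+1) / k! *)
Definition rbinomial (a : R) k : R := (\prod_(i < k) (a - i%:R)) / k`!%:R.

(* Szego, Orthogonal Polynomials, (4.3.2); normalised by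
   P_m(1) = rbinomial (m + al) m. *)
Definition jacobi al be m : {poly R} :=
  \sum_(k < m.+1)
    (rbinomial (m%:R + al) (m - k) * rbinomial (m%:R + be) k)
      *: ((2^-1 *: ('X - 1)) ^+ k * (2^-1 *: ('X + 1)) ^+ (m - k)).

Definition jacobi_sqnorm al be m : R :=
  \int[mu]_(t in Iab)
    ((1 - t) `^ al * (1 + t) `^ be * (jacobi al be m).[t] ^+ 2).

Definition psi_even al m x : R :=
  2 `^ ((2 * al + 1) / 4) / Num.sqrt (jacobi_sqnorm al (- 2^-1) m)
  * (cosh x `^ (1 + al))^-1
  * (jacobi al (- 2^-1) m).[1 - 2 / cosh x ^+ 2].

Definition psi_odd al m x : R :=
  - (2 `^ ((2 * al + 3) / 4) / Num.sqrt (jacobi_sqnorm al (2^-1) m)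
     * (sinh x / cosh x `^ (2 + al))
     * (jacobi al (2^-1) m).[1 - 2 / cosh x ^+ 2]).

Definition psi al n : R -> R :=
  if odd n then psi_odd al n./2 else psi_even al n./2.

Definition orthonormal_L2 (phi : nat -> R -> R) : Prop :=
  (forall m, phi m \in Lfun mu 2%:E) /\
  (forall m n, \int[mu]_x (phi m x * phi n x) = (m == n)%:R).

Definition tridiagonal_skew_differentiation (phi : nat -> R -> R) : Prop :=
  exists b : nat -> R,
    (forall m, 0 < b m) /\
    forall m x, is_derive x 1 (phi m)
      (b m * phi m.+1 x - (if m is k.+1 then b k * phi k x else 0)).

Definition is_density (w : R -> R) : Prop :=
  measurable_fun Iab w /\ (forall t, t \in Iab -> 0 <= w t).

Definition orthonormal_polynomials (w : R -> R) (p : nat -> {poly R}) : Prop :=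
  (forall m, size (p m) = m.+1) /\
  (forall m n,
     mu.-integrable Iab (fun t => ((p m).[t] * (p n).[t] * w t)%:E) /\
     \int[mu]_(t in Iab) ((p m).[t] * (p n).[t] * w t) = (m == n)%:R).

(* [H] is the inverse of the increasing bijection [h] from (-1, 1) onto
   (0, +oo), extended to an even function on the line with [H 0 = -1];
   the values of [h] outside (-1, 1) are irrelevant. *)
Record half_range_change (h H : R -> R) : Prop := {
  hrc_onto : h @` Iab = `]0, +oo[%classic;
  hrc_derivable : forall t, t \in Iab -> derivable h t 1;
  hrc_measurable : measurable_fun Iab (derive1 h);
  hrc_gt0 : forall t, t \in Iab -> 0 < derive1 h t;
  hrc_HK : forall t, t \in Iab -> H (h t) = t;
  hrc_Hderivable : forall x, 0 < x -> derivable H x 1;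
  hrc_derive : forall t, t \in Iab -> derive1 h t * derive1 H (h t) = 1;
  hrc_even : forall x, H (- x) = H x;
  hrc_0 : H 0 = -1 }.

Definition bounded_multiplier (theta w h : R -> R) : Prop :=
  (fun t => theta t * Num.sqrt (w t / derive1 h t)) \_ Iab \in Lfun mu +oo%E.

Record half_range_data (wE wO : R -> R) (r s : nat -> {poly R})
    (h H thetaE thetaO ThetaE ThetaO : R -> R) (phi : nat -> R -> R) : Prop := {
  hr_densityE : is_density wE;
  hr_densityO : is_density wO;
  hr_polyE : orthonormal_polynomials wE r;
  hr_polyO : orthonormal_polynomials wO s;
  hr_change : half_range_change h H;
  hr_boundE : bounded_multiplier thetaE wE h;
  hr_boundO : bounded_multiplier thetaO wO h;
  hr_evenE : forall x, ThetaE (- x) = ThetaE x;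
  hr_oddO : forall x, ThetaO (- x) = - ThetaO x;
  hr_ThetaE : forall x, 0 < x ->
    ThetaE x = thetaE (H x) * derive1 H x * wE (H x);
  hr_ThetaO : forall x, 0 < x ->
    ThetaO x = thetaO (H x) * derive1 H x * wO (H x);
  hr_ThetaE0 : ThetaE 0 != 0;
  hr_phi_even : forall m x, phi m.*2 x = ThetaE x * (r m).[H x];
  hr_phi_odd : forall m x, phi m.*2.+1 x = ThetaO x * (s m).[H x] }.

Definition half_range_form (phi : nat -> R -> R) : Prop :=
  exists (wE wO : R -> R) (r s : nat -> {poly R})
    (h H thetaE thetaO ThetaE ThetaO : R -> R),
    half_range_data wE wO r s h H thetaE thetaO ThetaE ThetaO phi.

Definition half_range_system (phi : nat -> R -> R) : Prop :=
  [/\ half_range_form phi, orthonormal_L2 phi &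
      tridiagonal_skew_differentiation phi].

End Definitions.

(* Main.v *)
Require Import Defs.
From HB Require Import structures.
From mathcomp Require Import all_boot all_order all_algebra.
From mathcomp Require Import all_classical all_reals all_analysis.
From mathcomp Require Import measurable_realfun ess_sup_inf.
From mathcomp Require Import ring lra.

Set Implicit Arguments.
Unset Strict Implicit.
Unset Printing Implicit Defensive.

Import Order.TTheory GRing.Theory Num.Theory.
Import numFieldNormedType.Exports.

Local Open Scope classical_set_scope.
Local Open Scope ring_scope.

(** Write p = 1 + alpha, c = cosh x and tau = tanh x.

    Existence. Since 1 - 2 / c^2 = 2 tau^2 - 1, each psi_n equals
    c^(-p) Q_n(tau) for a polynomial Q_n of degree n, a multiple of
    P_m^(alpha,-1/2)(2 tau^2 - 1) or of tau P_m^(alpha,1/2)(2 tau^2 - 1):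
    the quadratic transformation turns both Jacobi families into one family of
    Gegenbauer polynomials.  Differentiating c^(-p) F(tau) gives c^(-p) times
    the polynomial D F = (1 - X^2) F' - p X F, so everything takes place in the
    polynomial ring, with the functional L(F) = integral over R of
    c^(-2p) F(tau).  The integral of a derivative being zero,
    L((1 - X^2) F' - 2 p X F) = 0.  This one identity makes D skew for L
    ([ladder_skew]) and the Gegenbauer operator symmetric, hence the Q_n
    orthogonal because its eigenvalues are distinct
    ([gegenbauer_eigen_orthogonal]).  As D raises the degree by one, skewness
    and orthogonality leave only the two neighbours of Q_n in the expansion of
    D Q_n, and the alternating signs of the leading coefficients make the b_n
    positive ([ladder_tridiagonal]).  The substitution t = 2 tanh^2 x - 1
    carries the Jacobi weights to c^(-2p) and tau^2 c^(-2p); it gives the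
    normalising constants and the half-range form.

    Uniqueness. For a half-range system put f = phi_0, g = phi_1 and u = g / f.
    The equations for phi_0', phi_1', phi_2', phi_3' say that
      u' = C + D H - b u^2,  H' = u (A + B H),  u H' = q0 + q1 H + q2 H^2,
    where f has no zero, since at such a point g would vanish too and the
    linear system for (f, g) would give f = g = 0 everywhere.  Hence
    H'^2 = (1 + H) M(H) with M quadratic, the factor 1 + H coming from
    u(0) = 0 and H(0) = -1.  H needs an infinite time to reach 1, which forces
    a double root of M at 1 ([quadratic_ge_linear] is the comparison behind
    this).  Then A + B H is a multiple of 1 - H, u^2 a multiple of 1 + H, and
    the system integrates to H = 2 tanh^2(a x) - 1 and
    f = f(0) cosh(a x)^(-q) ([half_range_first_function]).  Finiteness of the
    norm forces q > 0, so f is, up to sign, the rescaled psi_0 with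
    alpha = q - 1.  Finally phi_0 determines the whole system
    ([tridiagonal_unique]): phi_(m+1) is known up to the positive factor 1 / b_m,
    which the normalisation fixes. *)

(** * The ladder and Gegenbauer operators on polynomials *)

Section Gegenbauer.
Variables (R : realFieldType) (p : R).
Implicit Types F G : {poly R}.

(** The derivative of [cosh^-p F(tanh)] is [cosh^-p (ladder F)(tanh)]. *)
Definition ladder F : {poly R} := (1 - 'X^2) * F^`() - p *: ('X * F).

Definition gegenbauer_op F : {poly R} :=
  (1 - 'X^2) * F^`()^`() - (2 * p) *: ('X * F^`()).

Lemma size_ladder F n : (size F <= n.+1)%N -> (size (ladder F) <= n.+2)%N.
Proof.
move=> sF; have sXF : (size (p *: ('X * F)) <= n.+2)%N.
  apply: (leq_trans (size_scale_leq _ _)); apply: (leq_trans (size_polyMleq _ _)).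
  by rewrite size_polyX.
apply: (leq_trans (size_polyD _ _)); rewrite geq_max size_polyN sXF andbT.
have [->|F'0] := eqVneq F^`() 0; first by rewrite mulr0 size_poly0.
apply: (leq_trans (size_polyMleq _ _)).
have s1 : (size ((1 - 'X^2)%R : {poly R}) <= 3)%N.
  apply: (leq_trans (size_polyD _ _)).
  by rewrite size_polyN size_polyXn size_poly1.
have : (size F^`() <= n)%N.
  have F0 : F != 0 by apply: contraNneq F'0 => ->; rewrite deriv0.
  by rewrite -ltnS (leq_trans (lt_size_deriv F0)).
by move=> s2; rewrite -subn1 leq_subLR; apply: leq_trans (leq_add s1 s2) _.
Qed.

Lemma lead_ladder F n : size F = n.+1 ->
  (ladder F)`_n.+1 = - (n%:R + p) * lead_coef F.
Proof.
move=> sF; rewrite lead_coefE sF /= /ladder mulrBl mul1r !coefB coefZ coefXM /=.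
rewrite coef_deriv coefXnM (nth_default _ (n := n.+2)) ?sF// mul0rn add0r.
case: n sF => [|n] sF /=; first by rewrite oppr0 !add0r mulNr.
rewrite subn2 /= coef_deriv.
by rewrite -mulr_natl; ring.
Qed.

(** Here [L] stands for integration against a weight [w] on (-1, 1) with
    [((1 - t^2) w)' = - 2 p t w], that is [w = (1 - t^2)^(p - 1)]; only the
    integrated form of that equation matters. *)
Section PearsonFunctional.
Variable L : {poly R} -> R.
Hypothesis L_linear : forall a F G, L (a *: F + G) = a * L F + L G.
Hypothesis L_pearson :
  forall F, L ((1 - 'X^2) * F^`() - (2 * p) *: ('X * F)) = 0.

Let L0 : L 0 = 0.
Proof.
have := L_linear 1 0 0; rewrite scaler0 addr0 mul1r => /eqP.
by rewrite -subr_eq subrr => /eqP.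
Qed.
Let LZ a F : L (a *: F) = a * L F.
Proof. by have := L_linear a F 0; rewrite L0 !addr0. Qed.
Let LD F G : L (F + G) = L F + L G.
Proof. by have := L_linear 1 F G; rewrite scale1r mul1r. Qed.
Let LN F : L (- F) = - L F.
Proof. by rewrite -scaleN1r LZ mulN1r. Qed.

(** [ladder F * G + F * ladder G] is the polynomial on which the Pearson
    identity makes [L] vanish, taken at [F * G]. *)
Lemma ladder_skew F G : L (ladder F * G) = - L (F * ladder G).
Proof.
apply/eqP; rewrite -addr_eq0 -LD -[X in _ == X](L_pearson (F * G)).
apply/eqP; congr L; rewrite /ladder derivM -!mul_polyC polyCM; ring.
Qed.

(** The Pearson identity at the Wronskian [F' G - F G'] is the symmetry of the
    Gegenbauer operator. *)
Lemma gegenbauer_eigen_orthogonal F G lam nu :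
    gegenbauer_op F = lam *: F -> gegenbauer_op G = nu *: G -> lam != nu ->
  L (F * G) = 0.
Proof.
move=> eF eG lamnu; have := L_pearson (F^`() * G - F * G^`()).
have -> : (1 - 'X^2) * (F^`() * G - F * G^`())^`()
    - (2 * p) *: ('X * (F^`() * G - F * G^`())) = (lam - nu) *: (F * G).
  transitivity (gegenbauer_op F * G - F * gegenbauer_op G).
    by rewrite /gegenbauer_op derivB !derivM -!mul_polyC polyCM; ring.
  by rewrite eF eG -!mul_polyC polyCB; ring.
rewrite LZ => /eqP; rewrite mulf_eq0 subr_eq0 (negPf lamnu) => /eqP//.
Qed.

Variable Q : nat -> {poly R}.
Hypothesis size_Q : forall n, size (Q n) = n.+1.
Hypothesis ortho_Q : forall m n, L (Q m * Q n) = (m == n)%:R.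

Lemma split_lead F n : (size F <= n.+1)%N ->
  exists a G, (size G <= n)%N /\ F = a *: Q n + G.
Proof.
move=> sF; pose a := F`_n / lead_coef (Q n); exists a, (F - a *: Q n).
split; last by rewrite addrC subrK.
have lQ : lead_coef (Q n) != 0 by rewrite lead_coef_eq0 -size_poly_eq0 size_Q.
apply/leq_sizeP => j; rewrite leq_eqVlt => /predU1P[<-|nj].
  rewrite coefB coefZ /a [(Q n)`_n](_ : _ = lead_coef (Q n)).
    by rewrite divfK// subrr.
  by rewrite lead_coefE size_Q.
rewrite coefB coefZ !nth_default ?mulr0 ?subrr ?size_Q//.
exact: leq_trans nj.
Qed.

Lemma ortho_lower F n : (size F <= n)%N -> L (F * Q n) = 0.
Proof.
suff H k : forall F n, (size F <= k)%N -> (k <= n)%N -> L (F * Q n) = 0.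
  by move=> sF; apply: (H n).
elim: k => [|k IH] {F n} F n.
  by rewrite leqn0 size_poly_eq0 => /eqP-> _; rewrite mul0r L0.
move=> /split_lead [a [G [sG ->]]] kn.
by rewrite mulrDl -scalerAl LD LZ ortho_Q IH ?ltn_eqF ?mulr0 ?addr0// ltnW.
Qed.

Lemma ortho_complete F n : (size F <= n)%N ->
  (forall k, (k < n)%N -> L (F * Q k) = 0) -> F = 0.
Proof.
elim: n F => [F|n IH F]; first by rewrite leqn0 size_poly_eq0 => /eqP.
move=> /split_lead [a [G [sG eF]]] FQ.
have a0 : a = 0.
  have := FQ n (ltnSn n).
  by rewrite eF mulrDl -scalerAl LD LZ ortho_Q eqxx mulr1 ortho_lower// addr0.
rewrite eF a0 scale0r add0r in FQ *.
by apply: IH => // k kn; apply: FQ; apply: ltnW.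
Qed.

Hypothesis p_gt0 : 0 < p.
Hypothesis sign_Q : forall n, lead_coef (Q n) * lead_coef (Q n.+1) < 0.

(** Skewness transfers the bound on the degree of [ladder (Q k)] into the
    vanishing of the coefficients of [ladder (Q m)] below [m - 1], and kills
    the diagonal one; the sign of [b m] is read off the leading coefficients. *)
Lemma ladder_tridiagonal :
  exists b : nat -> R, (forall m, 0 < b m) /\
    forall m, ladder (Q m) = b m *: Q m.+1 - (if m is k.+1 then b k *: Q k else 0).
Proof.
have L_expand F a G1 G2 H :
    L ((F - (a *: G1 - G2)) * H) = L (F * H) + (L (G2 * H) - a * L (G1 * H)).
  by rewrite opprB mulrDl LD mulrBl LD LN -scalerAl LZ.
pose b m := L (ladder (Q m) * Q m.+1); exists b.
have eQ m : ladder (Q m) = b m *: Q m.+1 - (if m is k.+1 then b k *: Q k else 0).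
  apply/eqP; rewrite -subr_eq0; apply/eqP; apply: (@ortho_complete _ m.+2).
    rewrite opprB; apply: (leq_trans (size_polyD _ _)); rewrite geq_max.
    rewrite size_ladder ?size_Q//=; apply: (leq_trans (size_polyD _ _)).
    rewrite geq_max size_polyN; apply/andP; split; last first.
      by apply: (leq_trans (size_scale_leq _ _)); rewrite size_Q.
    case: m => [|m]; first by rewrite size_poly0.
    apply: (leq_trans (size_scale_leq _ _)); rewrite size_Q.
    by apply: ltnW; apply: ltnW.
  move=> k; rewrite ltnS => km.
  rewrite L_expand ortho_Q.
  have [->|] := eqVneq k m.+1.
    rewrite mulr1 -/(b m); case: m {km} => [|m].
      by rewrite mul0r L0 sub0r subrr.
    by rewrite -scalerAl LZ ortho_Q ltn_eqF ?leqnSn// mulr0 sub0r subrr.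
  rewrite mulr0 subr0 => kNm.
  have {km kNm} : (k <= m)%N by rewrite -ltnS ltn_neqAle kNm.
  rewrite leq_eqVlt => /predU1P[->|km].
    have -> : L (ladder (Q m) * Q m) = 0.
      have := ladder_skew (Q m) (Q m); rewrite [in X in _ = X]mulrC; lra.
    case: m => [|m]; first by rewrite mul0r L0 addr0.
    by rewrite -scalerAl LZ ortho_Q ltn_eqF ?mulr0 ?addr0.
  case: m km => [//|m]; rewrite ltnS leq_eqVlt => /predU1P[->|km].
    rewrite ladder_skew [Q _ * ladder _]mulrC -/(b m) -scalerAl LZ ortho_Q eqxx mulr1.
    by rewrite addNr.
  rewrite ladder_skew [Q _ * ladder _]mulrC (@ortho_lower (ladder _)) ?oppr0 ?add0r; last first.
    by apply: (@leq_trans k.+2) => //; apply: size_ladder; rewrite size_Q.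
  by rewrite -scalerAl LZ ortho_Q gtn_eqF ?mulr0.
split=> // m.
have := lead_ladder (size_Q m).
rewrite eQ coefB coefZ [(Q m.+1)`_m.+1](_ : _ = lead_coef (Q m.+1)); last first.
  by rewrite lead_coefE size_Q.
rewrite [X in _ - X](_ : _ = 0) ?subr0; last first.
  case: m => [|m]; first by rewrite coef0.
  by rewrite coefZ nth_default ?mulr0// size_Q.
have := sign_Q m; set u := lead_coef _; set v := lead_coef _ => uv e.
have v0 : v != 0 by apply: contraTneq uv => ->; rewrite mulr0 ltxx.
have : b m * v ^+ 2 = (m%:R + p) * - (u * v).
  by rewrite expr2 mulrA e; ring.
have mp : 0 < m%:R + p by rewrite ltr_wpDl ?ler0n.
move=> e2; have : 0 < b m * v ^+ 2 by rewrite e2 mulr_gt0 ?oppr_gt0.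
by rewrite pmulr_lgt0// exprn_even_gt0.
Qed.

End PearsonFunctional.
End Gegenbauer.

(** * The Jacobi differential equation and its quadratic transformation *)

Section JacobiPolynomials.
Context {R : realType}.
Implicit Types (al be p : R).

Lemma rbinomialS (a : R) k :
  rbinomial a k.+1 * k.+1%:R = rbinomial a k * (a - k%:R).
Proof.
rewrite /rbinomial big_ord_recr/= factS natrM; field.
by rewrite pnatr_eq0 -lt0n fact_gt0 nat1r pnatr_eq0.
Qed.

Lemma rbinomial_gt0 (a : R) k : k%:R < a + 1 -> 0 < rbinomial a k.
Proof.
move=> ka; rewrite /rbinomial divr_gt0 ?ltr0n ?fact_gt0//.
apply: prodr_gt0 => i _; have : (i.+1%:R : R) <= k%:R by rewrite ler_nat.
by rewrite -natr1; lra.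
Qed.

(* With A and B = A + 1 as variables the Jacobi sum is homogeneous of degree m
   and the differential operator preserves this homogeneity. *)
Let A : {poly R} := 2^-1 *: ('X - 1).
Let B : {poly R} := 2^-1 *: ('X + 1).
Let T k l : {poly R} := A ^+ k * B ^+ l.

Let half2 : (2^-1)%:P * 2%:R = 1 :> {poly R}.
Proof. by rewrite -polyC_natr -polyCM mulVf ?pnatr_eq0. Qed.

Let B_E : B = A + 1.
Proof.
transitivity (A + (2^-1)%:P * 2%:R); last by rewrite half2.
by rewrite /A /B -!mul_polyC; ring.
Qed.

Let X_E : 'X = A + B :> {poly R}.
Proof.
transitivity ((2^-1)%:P * 2%:R * 'X : {poly R}); first by rewrite half2 mul1r.
by rewrite /A /B -!mul_polyC; ring.
Qed.

Let derivT k l :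
  2 *: (T k l)^`() = k%:R *: T k.-1 l + l%:R *: T k l.-1.
Proof.
have dA : A^`() = (2^-1)%:P.
  by rewrite derivZ derivB derivX derivC subr0 alg_polyC.
have dB : B^`() = (2^-1)%:P.
  by rewrite derivZ derivD derivX derivC addr0 alg_polyC.
have h2 : 2%:P * (2^-1)%:P = 1 :> {poly R} by rewrite -polyCM mulfV ?pnatr_eq0.
rewrite /T derivM !deriv_exp dA dB -!mul_polyC !polyC_natr.
rewrite -[_ *+ k]mulr_natl -[_ *+ l]mulr_natl.
transitivity ((2%:P * (2^-1)%:P) * (k%:R * (A ^+ k.-1 * B ^+ l)
  + l%:R * (A ^+ k * B ^+ l.-1))); last by rewrite h2 mul1r.
by rewrite polyC_natr; ring.
Qed.

Definition jacobi_op al be (F : {poly R}) : {poly R} :=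
  (1 - 'X^2) * F^`()^`() + ((be - al)%:P - (al + be + 2) *: 'X) * F^`().

Let jacobi_opE al be F : jacobi_op al be F =
  - (A * B) * (2 *: (2 *: F^`())^`())
  - ((be + 1) *: A + (al + 1) *: B) * (2 *: F^`()).
Proof.
rewrite /jacobi_op derivZ X_E B_E -!mul_polyC !(polyCM, polyCD, polyCB, polyCN, polyC_natr).
ring.
Qed.

Let jacobi_op_T al be k l :
  jacobi_op al be (T k l) = - ((k + l)%:R * ((k + l)%:R + al + be + 1)) *: T k l
    + (l%:R * (l%:R + be)) *: T k l.-1 - (k%:R * (k%:R + al)) *: T k.-1 l.
Proof.
rewrite jacobi_opE derivT derivD !derivZ scalerDr.
rewrite (scalerA 2 k%:R) (scalerA 2 l%:R) ![2 * _]mulrC -!(scalerA _ 2) !derivT.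
rewrite /T B_E; set a := A; clearbody a.
rewrite -!mul_polyC !(polyCM, polyCD, polyCB, polyCN, polyC1, polyC_natr).
case: k => [|[|k]]; case: l => [|[|l]] /=.
all: move: (al%:P) (be%:P) => u v; rewrite ?exprS ?expr0; ring.
Qed.

Let jacobi_op_sum al be (I : Type) (r : seq I) (c : I -> R) (F : I -> {poly R}) :
  jacobi_op al be (\sum_(i <- r) c i *: F i)
  = \sum_(i <- r) c i *: jacobi_op al be (F i).
Proof.
have opD : {morph jacobi_op al be : f g / f + g}.
  by move=> f g; rewrite /jacobi_op !derivD !mulrDr addrACA.
have op0 : jacobi_op al be 0 = 0 by rewrite /jacobi_op !deriv0 !mulr0 addr0.
rewrite (big_morph _ opD op0); apply: eq_bigr => i _.
by rewrite /jacobi_op !derivZ -!scalerAr -scalerDr.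
Qed.

(** The operator sends the k-th summand, up to the eigenvalue term, to
    [V k - W k], and the ratio of consecutive coefficients is exactly what
    makes [V k = W k.+1]: the sum telescopes. *)
Lemma jacobi_ode al be m : jacobi_op al be (jacobi al be m) =
  - (m%:R * (m%:R + al + be + 1)) *: jacobi al be m.
Proof.
rewrite /jacobi jacobi_op_sum scaler_sumr -/A -/B.
pose c k := rbinomial (m%:R + al) (m - k) * rbinomial (m%:R + be) k.
pose V k := ((m - k)%:R * ((m - k)%:R + be) * c k) *: T k (m - k).-1.
pose W k := (k%:R * (k%:R + al) * c k) *: T k.-1 (m - k).
apply/eqP; rewrite -subr_eq0 -sumrB; apply/eqP.
transitivity (\sum_(k < m.+1) (V k - W k)).
  apply: eq_bigr => k _; rewrite -/(T k (m - k)) jacobi_op_T subnKC; last by rewrite -ltnS.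
  rewrite -/(c k) /V /W -!mul_polyC !polyCM !polyCN; ring.
have VW k : (k < m)%N -> V k = W k.+1.
  move=> km; rewrite /V /W /= subnS; congr (_ *: _).
  have [l ml] : {l | m = (k + l).+1}.
    by exists (m - k.+1)%N; rewrite addnC -addnS subnK.
  have -> : (m - k = l.+1)%N by rewrite ml -addnS addKn.
  rewrite /c; have -> : (m - k = l.+1)%N by rewrite ml -addnS addKn.
  have -> : (m - k.+1 = l)%N by rewrite subnS ml -addnS addKn.
  have e1 := rbinomialS (m%:R + al) l; have e2 := rbinomialS (m%:R + be) k.
  transitivity ((rbinomial (m%:R + al) l.+1 * l.+1%:R)
    * ((l.+1%:R + be) * rbinomial (m%:R + be) k)); first ring.
  transitivity ((rbinomial (m%:R + be) k.+1 * k.+1%:R)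
    * ((k.+1%:R + al) * rbinomial (m%:R + al) l)); last ring.
  by rewrite e1 e2 ml -addn1 -[l.+1]addn1 -[k.+1]addn1 !natrD; ring.
have W0 : W 0%N = 0 by rewrite /W !mul0r scale0r.
have Vm : V m = 0 by rewrite /V subnn !mul0r scale0r.
rewrite sumrB big_ord_recr [X in _ - X]big_ord_recl [X in _ - (X + _)]W0.
rewrite [X in _ + X - _]Vm addr0 add0r; apply/eqP; rewrite subr_eq0; apply/eqP.
by apply: eq_bigr => k _; rewrite lift0 -VW. 
Qed.

(** Each summand has degree [m] with a positive leading coefficient, because
    the entries of the binomials exceed their lower indices minus one; nothing
    cancels. *)
Lemma size_jacobi al be m : -1 < al -> -1 < be ->
  size (jacobi al be m) = m.+1 /\ 0 < lead_coef (jacobi al be m).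
Proof.
move=> al1 be1.
have sT k : (k <= m)%N ->
    exists2 p : {poly R}, T k (m - k) = (2^-1 ^+ m) *: p & p \is monic /\ size p = m.+1.
  move=> km; exists (('X - 1%:P) ^+ k * ('X - (-1)%:P) ^+ (m - k)).
    by rewrite /T /A /B !exprZn -scalerAl -scalerAr scalerA -exprD subnKC// polyCN opprK.
  have mA := monic_exp k (monicXsubC (1 : R)).
  have mB := monic_exp (m - k) (monicXsubC (-1 : R)).
  split; first by rewrite monicMl.
  by rewrite size_Mmonic ?monic_neq0// !size_exp_XsubC addnS /= addSn subnKC.
have c_gt0 k : (k <= m)%N -> 0 < rbinomial (m%:R + al) (m - k) * rbinomial (m%:R + be) k.
  move=> km; apply: mulr_gt0; apply: rbinomial_gt0.
    by rewrite natrB//; have := ler0n R k; lra.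
  by have km' : (k%:R : R) <= m%:R; [rewrite ler_nat | lra].
have lead : 0 < (jacobi al be m)`_m.
  rewrite /jacobi coef_sum -/A -/B big_ord_recr/=.
  have pos k : (k <= m)%N -> 0 < (rbinomial (m%:R + al) (m - k) * rbinomial (m%:R + be) k
      *: (T k (m - k)))`_m.
    move=> km; rewrite coefZ mulr_gt0 ?c_gt0//; have [p -> [mp sp]] := sT _ km.
    by rewrite coefZ -[m in p`_m]/(m.+1.-1) -sp -lead_coefE (monicP mp) mulr1 exprn_gt0.
  rewrite ltr_wpDl ?pos//; apply: sumr_ge0 => k _; apply: ltW; apply: pos.
  exact: ltnW.
have sz : size (jacobi al be m) = m.+1.
  apply/eqP; rewrite eqn_leq; apply/andP; split; last first.
    by apply: contraTT lead; rewrite -leqNgt => /leq_sizeP ->; rewrite ?ltxx.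
  apply: (leq_trans (size_sum _ _ _)); apply/bigmax_leqP => k _.
  apply: (leq_trans (size_scale_leq _ _)); rewrite -/A -/B -/(T _ _).
  have [|p -> [_ sp]] := sT k; first by rewrite -ltnS.
  by apply: (leq_trans (size_scale_leq _ _)); rewrite sp.
by rewrite lead_coefE sz.
Qed.

Definition dbl_sqr : {poly R} := 2 *: 'X^2 - 1.

Lemma deriv_dbl_sqr : dbl_sqr^`() = 4 *: 'X.
Proof.
rewrite /dbl_sqr derivB derivZ derivXn derivC subr0 expr1 -mulr_natl -!mul_polyC.
by rewrite !polyC_natr; ring.
Qed.

Lemma size_dbl_sqr : size dbl_sqr = 3.
Proof.
rewrite /dbl_sqr size_polyDl ?size_polyN ?size_poly1 size_scale ?pnatr_eq0//.
  by rewrite size_polyXn.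
by rewrite size_polyXn.
Qed.

Lemma lead_coef_dbl_sqr : lead_coef dbl_sqr = 2.
Proof.
rewrite lead_coefE size_dbl_sqr /dbl_sqr coefB coefZ coefXn coef1/=.
by rewrite mulr1 subr0.
Qed.

Let jacobi_ode_comp al be m (P := jacobi al be m) :
  4 * (1 - dbl_sqr ^+ 2) * (P^`()^`() \Po dbl_sqr)
   + ((4 * be - 4 * al)%:P - (4 * al + 4 * be + 8)%:P * dbl_sqr)
     * (P^`() \Po dbl_sqr)
  = (- (2 * m%:R * (2 * m%:R + 2 * al + 2 * be + 2)))%:P * (P \Po dbl_sqr).
Proof.
have := congr1 (fun F => 4 * (F \Po dbl_sqr)) (jacobi_ode al be m).
rewrite /jacobi_op comp_polyD !comp_polyM !comp_polyB !comp_polyC comp_polyZ.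
rewrite comp_polyX comp_Xn_poly comp_polyZ -/P -!mul_polyC => e.
transitivity (4 * ((1 - dbl_sqr ^+ 2) * (P^`()^`() \Po dbl_sqr) +
   ((be - al)%:P - (al + be + 2)%:P * dbl_sqr) * (P^`() \Po dbl_sqr))).
  by rewrite !(polyCM, polyCD, polyCB, polyCN, polyC_natr); ring.
rewrite e !(polyCM, polyCD, polyCB, polyCN, polyC1, polyC_natr); ring.
Qed.

(** Quadratic transformation: the second order equation for
    [P_m^(al,-1/2)] at [2 X^2 - 1] is the Gegenbauer equation of the even
    degree [2 m]. *)
Lemma gegenbauer_even al m (F := jacobi al (- 2^-1) m \Po dbl_sqr) :
  gegenbauer_op (1 + al) F
  = - ((m.*2)%:R * ((m.*2)%:R + 2 * (1 + al) - 1)) *: F.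
Proof.
have := jacobi_ode_comp al (- 2^-1) m; rewrite /F; set P := jacobi _ _ _ => e.
rewrite /gegenbauer_op !deriv_comp derivM deriv_comp deriv_dbl_sqr derivZ derivX.
have e2 : 2 * - 2^-1 = -1 :> R by field.
have e4 : 4 * - 2^-1 = -2 :> R by field.
rewrite e2 e4 in e; rewrite -muln2 natrM.
set P0 := P \Po _ in e *; set P1 := P^`() \Po _ in e *.
set P2 := P^`()^`() \Po _ in e *.
rewrite (_ : m%:R * 2 * _ = 2 * m%:R * (2 * m%:R + 2 * al + -1 + 2)); last by ring.
rewrite -[RHS]mul_polyC -e -!mul_polyC /dbl_sqr.
by rewrite -!mul_polyC !(polyCM, polyCD, polyCB, polyCN, polyC1, polyC_natr); ring.
Qed.

(** The same for the odd degrees; the extra factor ['X] is what turns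
    [be = -1/2] into [be = 1/2]. *)
Lemma gegenbauer_odd al m (F := 'X * (jacobi al 2^-1 m \Po dbl_sqr)) :
  gegenbauer_op (1 + al) F
  = - ((m.*2.+1)%:R * ((m.*2.+1)%:R + 2 * (1 + al) - 1)) *: F.
Proof.
have := jacobi_ode_comp al 2^-1 m; rewrite /F; set P := jacobi _ _ _ => e.
rewrite /gegenbauer_op !derivM derivD !derivM derivX !deriv_comp derivM.
rewrite deriv_comp deriv_dbl_sqr derivZ derivX derivC.
have e2 : 2 * 2^-1 = 1 :> R by field.
have e4 : 4 * 2^-1 = 2 :> R by field.
rewrite e2 e4 in e; rewrite -[m.*2.+1]addn1 -[m.*2]muln2 natrD natrM.
set P0 := P \Po _ in e *; set P1 := P^`() \Po _ in e *.
set P2 := P^`()^`() \Po _ in e *.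
rewrite (_ : - _ = - (2 * m%:R * (2 * m%:R + 2 * al + 1 + 2))
  - 2 * (1 + al)); last by ring.
transitivity ('X * ((- (2 * m%:R * (2 * m%:R + 2 * al + 1 + 2)))%:P * P0)
  - (2 * (1 + al))%:P * ('X * P0)); last by rewrite -mul_polyC polyCB; ring.
rewrite -e -!mul_polyC /dbl_sqr -!mul_polyC.
by rewrite !(polyCM, polyCD, polyCB, polyCN, polyC1, polyC_natr); ring.
Qed.

End JacobiPolynomials.

(** * Integrals of derivatives over the real line *)

Section RealLine.
Context {R : realType}.
Local Notation mu := (@lebesgue_measure R).

Lemma derive_continuous (f df : R -> R) :
  (forall x, is_derive x (1 : R) f (df x)) -> continuous f.
Proof.
move=> fd x; apply/differentiable_continuous/derivable1_diffP.
exact: (@ex_derive _ _ _ _ _ _ _ (fd x)).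
Qed.

(** The fundamental theorem on [[-n, n]], and dominated convergence. *)
Lemma integral_derivative_line (f F : R -> R) :
  continuous f -> mu.-integrable [set: R] (EFin \o f) ->
  (forall x, is_derive x (1 : R) F (f x)) ->
  F x @[x --> +oo] --> (0 : R) -> F x @[x --> -oo] --> (0 : R) ->
  \int[mu]_x f x = 0.
Proof.
move=> cf intf dF Fy FNy.
have /measurable_EFinP mf : measurable_fun [set: R] f.
  exact: continuous_measurable_fun.
pose I n : set R := `[- n.+1%:R, n.+1%:R]%classic.
pose f_ n := ((EFin \o f) \_ (I n)).
have mf_ n : measurable_fun [set: R] (f_ n).
  apply/(measurable_restrictT _ _).1; first exact: measurable_itv.
  exact: measurable_funTS mf.
have f_f : {ae mu, forall x, [set: R] x -> f_ ^~ x @ \oo --> (EFin \o f) x}.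
  apply: aeW => x _; apply: cvg_near_cst; near=> n.
  rewrite /f_ patchE ifT// inE /I /= in_itv /= -ler_norml.
  rewrite -natr1 -lerBlDr; near: n; exact: nbhs_infty_ger.
have f_le : {ae mu, forall x n, [set: R] x -> (`|f_ n x| <= (abse \o (EFin \o f)) x)%E}.
  apply: aeW => x n _; rewrite /f_ patchE; case: ifP => //= _.
  by rewrite normr0 lee_fin.
have [_ _ lim_f] := @dominated_convergence _ _ R mu setT measurableT
  _ _ _ mf_ mf f_f
  (integrable_abse intf) f_le.
have cF := derive_continuous dF.
have int_f_ n : (\int[mu]_x f_ n x = (F n.+1%:R - F (- n.+1%:R))%:E)%E.
  rewrite -integral_mkcond EFinB; apply: continuous_FTC2.
  - by rewrite gtrN.
  - exact: continuous_subspaceT.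
  - split; first by move=> x _; exact: (@ex_derive _ _ _ _ _ _ _ (dF x)).
      by apply: cvg_at_right_filter; exact: cF.
    by apply: cvg_at_left_filter; exact: cF.
  - by move=> x _; rewrite derive1E; exact: (@derive_val _ _ _ _ _ _ _ (dF x)).
suff lim0 : (fun n => (\int[mu]_x f_ n x)%E) @ \oo --> 0%:E.
  by rewrite /Rintegral -(cvg_unique _ lim0 lim_f).
under eq_fun do rewrite int_f_.
apply: cvg_EFin; first exact: nearW.
have ny : (n.+1%:R : R) @[n --> \oo] --> +oo.
  by have := @cvgr_idn R; rewrite -cvg_shiftS.
rewrite -[0 in X in _ --> X]subr0; apply: cvgB.
  exact: cvg_comp ny Fy.
move/cvgNy_compNP : FNy => FNy.
exact: cvg_comp ny FNy.
Unshelve. all: by end_near. Qed.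
End RealLine.

(** * Hyperbolic functions and the powers of the hyperbolic secant *)

Section Hyperbolic.
Context {R : realType}.
Local Notation mu := (@lebesgue_measure R).
Implicit Types (x p : R) (F : {poly R}).

Definition tanh x : R := sinh x / cosh x.
(** The p-th power of the hyperbolic secant. *)
Definition gauge p x : R := (cosh x `^ p)^-1.

Lemma coshN x : cosh (- x) = cosh x.
Proof. by rewrite /cosh opprK addrC. Qed.

Lemma sinhN x : sinh (- x) = - sinh x.
Proof. by rewrite /sinh opprK -mulNr opprB. Qed.

Lemma cosh_gt0 x : 0 < cosh x.
Proof. by rewrite divr_gt0// addr_gt0// expR_gt0. Qed.
Hint Resolve cosh_gt0 : core.

Lemma cosh_neq0 x : cosh x != 0. Proof. by rewrite gt_eqF. Qed.
Hint Resolve cosh_neq0 : core.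

Lemma cosh2_sinh2 x : cosh x ^+ 2 - sinh x ^+ 2 = 1.
Proof.
transitivity (expR x * expR (- x)); last by rewrite expRxMexpNx_1.
by rewrite /cosh /sinh; field.
Qed.

Lemma cosh0 : cosh 0 = 1 :> R.
Proof. by rewrite /cosh oppr0 expR0; field. Qed.

Lemma sinh0 : sinh 0 = 0 :> R.
Proof. by rewrite /sinh oppr0 subrr mul0r. Qed.

Lemma sinh_gt0 x : 0 < x -> 0 < sinh x.
Proof. by move=> x0; rewrite divr_gt0// subr_gt0 ltr_expR; lra. Qed.

Lemma tanhN x : tanh (- x) = - tanh x.
Proof. by rewrite /tanh coshN sinhN mulNr. Qed.

Lemma tanh0 : tanh 0 = 0 :> R. Proof. by rewrite /tanh sinh0 mul0r. Qed.

Lemma tanh_gt0 x : 0 < x -> 0 < tanh x.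
Proof. by move=> x0; rewrite divr_gt0// sinh_gt0. Qed.

Lemma tanh2 x : tanh x ^+ 2 = 1 - (cosh x ^+ 2)^-1.
Proof.
have e : sinh x ^+ 2 = cosh x ^+ 2 - 1.
  by have := cosh2_sinh2 x; lra.
by rewrite /tanh expr_div_n e; field.
Qed.

Lemma norm_tanh_lt1 x : `|tanh x| < 1.
Proof.
rewrite -(@ltr_pXn2r _ 2)// ?nnegrE// expr1n real_normK ?num_real// tanh2.
by rewrite ltrBlDr ltrDl invr_gt0 exprn_gt0.
Qed.

Lemma is_derive_cosh x : is_derive x (1 : R) cosh (sinh x).
Proof.
rewrite /cosh /sinh; apply: is_derive_eq.
by rewrite /GRing.scale/=; field.
Qed.

Lemma is_derive_sinh x : is_derive x (1 : R) sinh (cosh x).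
Proof.
rewrite /cosh /sinh; apply: is_derive_eq.
by rewrite /GRing.scale/=; field.
Qed.

Lemma is_derive_tanh x : is_derive x (1 : R) tanh (1 - tanh x ^+ 2).
Proof.
have dc := is_derive_cosh x; have ds := is_derive_sinh x.
have dV : is_derive x (1 : R) (fun y => (cosh y)^-1) _ := is_deriveV (cosh_neq0 x) dc.
apply: (is_derive_eq (is_deriveM ds dV)).
by rewrite /tanh /GRing.scale/=; field.
Qed.

Lemma gaugeE p x : gauge p x = expR (- p * ln (cosh x)).
Proof. by rewrite /gauge /powR gt_eqF// -expRN mulNr. Qed.

Lemma gauge_gt0 p x : 0 < gauge p x.
Proof. by rewrite gaugeE expR_gt0. Qed.

Lemma gaugeN p x : gauge p (- x) = gauge p x.
Proof. by rewrite /gauge coshN. Qed.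

Lemma gauge0 p : gauge p 0 = 1 :> R.
Proof. by rewrite /gauge cosh0 powR1 invr1. Qed.

Lemma gauge_sqr p x : gauge p x ^+ 2 = gauge (2 * p) x.
Proof. by rewrite !gaugeE -expRM_natl; congr expR; ring. Qed.

Lemma is_derive_gauge p x : is_derive x (1 : R) (gauge p) (- p * tanh x * gauge p x).
Proof.
have dc := is_derive_cosh x.
have dl := is_derive1_comp (is_derive1_ln (cosh_gt0 x)) dc.
have dm := is_deriveZ (- p) dl.
rewrite (_ : gauge p = expR \o (- p \*: (@ln R \o cosh))); last first.
  apply/funext => y. by rewrite gaugeE/=.
apply: (is_derive_eq (is_derive1_comp (is_derive_expR _) dm) _).
by rewrite /tanh /GRing.scale/=; ring.
Qed.

Lemma horner_ladder p F y :
  (ladder p F).[y] = (1 - y ^+ 2) * F^`().[y] - p * (y * F.[y]).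
Proof. by rewrite /ladder !(hornerE, hornerXn). Qed.

Lemma is_derive_gauge_poly p F x :
  is_derive x (1 : R) (fun y => gauge p y * F.[tanh y]) (gauge p x * (ladder p F).[tanh x]).
Proof.
have dF := is_derive1_comp (is_derive_poly F (tanh x)) (is_derive_tanh x).
apply: (is_derive_eq (is_deriveM (is_derive_gauge p x) dF)).
by rewrite horner_ladder /GRing.scale/=; ring.
Qed.

End Hyperbolic.

(** * The Gegenbauer functional on the real line *)

Section Functional.
Context {R : realType}.
Local Notation mu := (@lebesgue_measure R).
Implicit Types (x p : R) (F : {poly R}).

Definition artanh (t : R) : R := ln ((1 + t) / (1 - t)) / 2.

Lemma tanhK : cancel (@tanh R) artanh.
Proof.
move=> x; rewrite /artanh.
suff -> : (1 + tanh x) / (1 - tanh x) = expR (2 * x).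
  by rewrite expRK; field.
have ep := expR_gt0 x; have en := expR_gt0 (- x).
have e2 : expR (2 * x) = expR x / expR (- x).
  by rewrite expRN invrK -expRD; congr expR; ring.
rewrite e2 /tanh /sinh /cosh; field.
by apply/and3P; split; apply/eqP; lra.
Qed.

Lemma horner_bounded F : exists M : R, forall y, `|y| <= 1 -> `|F.[y]| <= M.
Proof.
exists (\sum_(i < size F) `|F`_i|) => y y1; rewrite horner_coef.
apply: (le_trans (ler_norm_sum _ _ _)); apply: ler_sum => i _.
by rewrite normrM normrX ler_piMr// exprn_ile1.
Qed.

Lemma horner_tanh_bounded F : exists2 M : R, 0 <= M & forall x, `|F.[tanh x]| <= M.
Proof.
have [M MF] := horner_bounded F.
have FM x : `|F.[tanh x]| <= M by apply: MF; apply/ltW/norm_tanh_lt1.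
by exists M => //; apply: le_trans (FM 0).
Qed.

Lemma gauge_continuous p : continuous (gauge p).
Proof. exact: derive_continuous (@is_derive_gauge _ p). Qed.

Lemma gauge_poly_continuous p F : continuous (fun x => gauge p x * F.[tanh x]).
Proof. exact: derive_continuous (is_derive_gauge_poly p F). Qed.

(** From [cosh x >= exp x / 2]; evenness of [gauge] covers the negative
    half-line. *)
Lemma gauge_le_expR p x : 0 < p -> gauge p x <= expR (p * ln 2) * expR (- p * x).
Proof.
move=> p0; rewrite gaugeE -expRD ler_expR.
have : x - ln 2 <= ln (cosh x).
  rewrite -{1}[x]expRK -ln_div ?posrE ?expR_gt0//.
  rewrite ler_ln ?posrE ?divr_gt0 ?expR_gt0 ?addr_gt0 ?expR_gt0//.
  by rewrite /cosh ler_pM2r// lerDl expR_ge0.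
move=> h; have : p * (x - ln 2) <= p * ln (cosh x) by rewrite ler_pM2l.
lra.
Qed.

Lemma gauge_cvg0 p : 0 < p -> gauge p x @[x --> +oo] --> (0 : R).
Proof.
move=> p0; apply: (@squeeze_cvgr _ _ _ _ (cst 0)
    (fun x => expR (p * ln 2) * expR (- p * x))).
- by near=> x; rewrite (ltW (gauge_gt0 _ _)) gauge_le_expR.
- exact: cvg_cst.
- rewrite -(mulr0 (expR (p * ln 2))); apply: cvgM; first exact: cvg_cst.
  under eq_fun do rewrite mulNr.
  apply: cvg_comp (@cvgr_expR R).
  exact: gt0_cvgMry.
Unshelve. all: by end_near. Qed.

Lemma integrable_gauge p : 0 < p -> mu.-integrable [set: R] (EFin \o gauge p).
Proof.
move=> p0; have cg := @gauge_continuous p.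
set C := expR (p * ln 2).
have dE c (x : R) : is_derive x (1 : R) (fun y => c * expR (- p * y))
    (- (p * c) * expR (- p * x)).
  apply: is_derive_eq; rewrite /GRing.scale/=; ring.
have cE c : continuous (fun y => c * expR (- p * y)) := derive_continuous (dE c).
apply/integrableP; split.
  by apply/measurable_EFinP; exact: continuous_measurable_fun.
under eq_integral => x _ do rewrite /= (gtr0_norm (gauge_gt0 _ _)).
rewrite ge0_symfun_integralT//; last 2 first.
- by move=> x; rewrite ltW// gauge_gt0.
- by move=> x; rewrite /= gaugeN.
rewrite lte_mul_pinfty// -set_itvcy.
apply: (@le_lt_trans _ _ (\int[mu]_(x in `[0%R, +oo[) (C * expR (- p * x))%:E)%E).
  apply: ge0_le_integral => //.
  + by move=> x _; rewrite lee_fin ltW// gauge_gt0.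
  + apply/measurable_EFinP; apply: measurable_funTS; exact: continuous_measurable_fun.
  + apply/measurable_EFinP; apply: measurable_funTS; exact: continuous_measurable_fun.
  + by move=> x _; rewrite lee_fin gauge_le_expR.
rewrite (@ge0_continuous_FTC2y _ _ (fun x => - (C / p) * expR (- p * x)) 0 0) ?ltry//.
- by move=> x _; rewrite mulr_ge0 ?expR_ge0.
- exact: continuous_subspaceT.
- rewrite -(mulr0 (- (C / p))); apply: cvgM; first exact: cvg_cst.
  under eq_fun do rewrite mulNr.
  apply: cvg_comp (@cvgr_expR R).
  exact: gt0_cvgMry.
- by apply: cvg_at_right_filter; exact: cE.
- move=> x _; rewrite derive1E (@derive_val _ _ _ _ _ _ _ (dE (- (C / p)) x)).
  by congr (_ * _); field; rewrite gt_eqF.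
Qed.

Lemma integrable_gauge_poly p F : 0 < p ->
  mu.-integrable [set: R] (EFin \o (fun x => gauge p x * F.[tanh x])).
Proof.
move=> p0; have [M M0 MF] := horner_tanh_bounded F.
have iM := integrableZl measurableT M (integrable_gauge p0).
apply: (le_integrable measurableT _ _ iM).
- by apply/measurable_EFinP; apply: continuous_measurable_fun; exact: gauge_poly_continuous.
- move=> x _; rewrite -EFinM lee_fin !normrM (ger0_norm M0).
  by rewrite (gtr0_norm (gauge_gt0 _ _)) mulrC ler_pM2r ?gauge_gt0.
Qed.

Lemma gauge_poly_cvg0 p F : 0 < p ->
  gauge p x * F.[tanh x] @[x --> +oo] --> (0 : R).
Proof.
move=> p0; have [M M0 MF] := horner_tanh_bounded F.
have lim0 : M * gauge p x @[x --> +oo] --> (0 : R).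
  by rewrite -(mulr0 M); apply: cvgM; [exact: cvg_cst | exact: gauge_cvg0].
apply: (@squeeze_cvgr _ _ _ _ (fun x => - (M * gauge p x)) (fun x => M * gauge p x)) => //.
- near=> x; rewrite -ler_norml normrM (gtr0_norm (gauge_gt0 _ _)) mulrC.
  by rewrite ler_pM2r ?gauge_gt0.
- by rewrite -oppr0; apply: cvgN.
Unshelve. all: by end_near. Qed.

(** In the variable [tanh x] this is the integral of [F] over (-1, 1) against
    the Gegenbauer weight [(1 - t^2)^(p - 1)]; on the real line the integrands
    have no endpoint singularity. *)
Definition gauge_integral p F : R := \int[mu]_x (gauge (2 * p) x * F.[tanh x]).

Lemma gauge_integral_linear p a F G : 0 < p ->
  gauge_integral p (a *: F + G) = a * gauge_integral p F + gauge_integral p G.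
Proof.
move=> p0; have p2 : 0 < 2 * p by rewrite mulr_gt0.
have iF := integrable_gauge_poly F p2; have iG := integrable_gauge_poly G p2.
rewrite /gauge_integral -RintegralZl// -RintegralD//; last first.
  exact: (integrableZl _ _ iF).
by apply: eq_Rintegral => x _; rewrite hornerD hornerZ; ring.
Qed.

(** The integrand is the derivative of [gauge (2 * p) x * F.[tanh x]], which
    vanishes at both ends. *)
Lemma gauge_integral_pearson p F : 0 < p ->
  gauge_integral p (ladder (2 * p) F) = 0.
Proof.
move=> p0; have p2 : 0 < 2 * p by rewrite mulr_gt0.
apply: (@integral_derivative_line _ _ (fun x => gauge (2 * p) x * F.[tanh x])).
- exact: gauge_poly_continuous.
- exact: integrable_gauge_poly.
- exact: is_derive_gauge_poly.
- exact: gauge_poly_cvg0.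
- apply/cvgNy_compNP.
  have := @gauge_poly_cvg0 (2 * p) (F \Po - 'X) p2; apply: cvg_trans.
  apply: near_eq_cvg; near=> x.
  by rewrite /= gaugeN tanhN horner_comp hornerN hornerX.
Unshelve. all: by end_near. Qed.

Lemma Rintegral_continuous_gt0 (f : R -> R) x0 : continuous f ->
  mu.-integrable [set: R] (EFin \o f) -> (forall x, 0 <= f x) -> 0 < f x0 ->
  0 < \int[mu]_x f x.
Proof.
move=> cf intf f0 fx0.
have [d d0 fd] : exists2 d, 0 < d & forall x, `|x0 - x| <= d -> f x0 / 2 <= f x.
  have : \forall x \near x0, f x0 / 2 < f x.
    have := cf x0 => /cvgr_gt; apply; lra.
  case/nbhs_ballP => e /= e0 be; exists (e / 2); first by rewrite divr_gt0.
  move=> x xe; apply/ltW/be; rewrite /ball/= (le_lt_trans xe)//; lra.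
pose I : set R := `[x0 - d, x0 + d]%classic.
have measI : measurable I by exact: measurable_itv.
rewrite -lte_fin /Rintegral fineK; last exact: integrable_fin_num.
apply: (@lt_le_trans _ _ (\int[mu]_(x in I) (f x0 / 2)%:E)%E).
  have mI : mu I = (2 * d)%:E.
    rewrite /I lebesgue_measure_itv/= lte_fin ifT; last lra.
    by rewrite -EFinB; congr EFin; ring.
  rewrite integral_cst; last exact: measI.
  by rewrite [X in (_ * X)%E]mI -EFinM lte_fin mulr_gt0//; lra.
apply: (@le_trans _ _ (\int[mu]_(x in I) (f x)%:E)%E).
  apply: ge0_le_integral => //.
  - by move=> x _; rewrite lee_fin; lra.
  - by apply/measurable_EFinP; apply: measurable_funTS; exact: continuous_measurable_fun.
  - move=> x; rewrite /I /= in_itv/= => /andP[x1 x2]; rewrite lee_fin fd// ler_norml; lra.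
apply: ge0_subset_integral => //.
- by apply/measurable_EFinP; exact: continuous_measurable_fun.
- by move=> x _; rewrite lee_fin.
Qed.

Lemma poly_tanh_neq0 F : F != 0 -> exists x : R, F.[tanh x] != 0.
Proof.
move=> F0; apply/not_existsP => FT.
pose rs := [seq tanh (k%:R : R) | k <- iota 0 (size F)].
have : (size rs < size F)%N.
  apply: max_poly_roots => //.
    apply/allP => y /mapP[k _ ->]; apply/negPn/negP; exact: FT.
  rewrite map_inj_uniq ?iota_uniq// => m n /(can_inj tanhK)/eqP.
  by rewrite eqr_nat => /eqP.
by rewrite size_map size_iota ltnn.
Qed.

Lemma gauge_integral_sqr_gt0 p F : 0 < p -> F != 0 -> 0 < gauge_integral p (F ^+ 2).
Proof.
move=> p0 /poly_tanh_neq0[x0 Fx0]; have p2 : 0 < 2 * p by rewrite mulr_gt0.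
apply: (@Rintegral_continuous_gt0 _ x0).
- exact: gauge_poly_continuous.
- exact: integrable_gauge_poly.
- by move=> x; rewrite horner_exp mulr_ge0 ?sqr_ge0// ltW ?gauge_gt0.
- by rewrite horner_exp mulr_gt0 ?gauge_gt0// exprn_even_gt0.
Qed.

End Functional.

(** * Change of variables from a ray to an interval *)

Section Substitution.
Context {R : realType}.
Local Notation mu := (@lebesgue_measure R).

(** [G] may blow up at both ends of [`]H 0, l[], so the substitution is made
    on the compact intervals [[1 / (n + 1), n + 1]], whose union is the ray,
    followed by monotone convergence on both sides. *)
Lemma ge0_substitution_ray (H dH G : R -> R) (l : R) :
  (forall x, is_derive x (1 : R) H (dH x)) -> continuous dH ->
  (forall x, 0 < x -> 0 <= dH x) ->
  {in `[0, +oo[ &, {homo H : x y / x < y}} ->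
  (forall x, 0 <= x -> H x < l) -> H x @[x --> +oo] --> l ->
  {in `]H 0, l[, continuous G} -> {in `]H 0, l[, forall t, 0 <= G t} ->
  (\int[mu]_(t in `]H 0%R, l[) (G t)%:E
   = \int[mu]_(x in `]0%R, +oo[) (G (H x) * dH x)%:E)%E.
Proof.
move=> dHE cdH dH0 incH Hl limH cG G0.
have cH := derive_continuous dHE.
have dHD : derive1 H = dH.
  by apply/funext => x; rewrite derive1E (@derive_val _ _ _ _ _ _ _ (dHE x)).
have Hin x : 0 < x -> H x \in `]H 0, l[.
  by move=> x0; rewrite in_itv/= Hl ?(ltW x0)// incH// in_itv/= ?lexx ?ltW.
have cGH x : 0 < x -> {for x, continuous (fun y => G (H y) * dH y)}.
  move=> x0; apply: continuousM; last exact: cdH.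
  by apply: continuous_comp; [exact: cH | apply: cG; exact: Hin].
have mG : measurable_fun `]H 0, l[ G.
  apply: open_continuous_measurable_fun; first exact: interval_open.
  by move=> t; rewrite inE/=; exact: cG.
have mGH : measurable_fun (`]0, +oo[%classic : set R) (fun y => G (H y) * dH y).
  apply: open_continuous_measurable_fun; first exact: interval_open.
  by move=> t; rewrite inE/= in_itv/= andbT; exact: cGH.
pose a n : R := n.+1%:R^-1; pose b n : R := n.+1%:R.
have a0 n : 0 < a n by rewrite invr_gt0.
have b0 n : 0 < b n by [].
have ab n : a n <= b n.
  by apply: (@le_trans _ _ 1); rewrite ?invf_le1// ?ler1n.
have incH' x y : 0 < x -> x <= y -> H x <= H y.
  move=> x0; rewrite le_eqVlt => /predU1P[->//|xy]; apply/ltW/incH => //.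
    by rewrite in_itv/= (ltW x0).
  by rewrite in_itv/= andbT (le_trans (ltW x0))// ltW.
have aS m n : (m <= n)%N -> a n <= a m.
  by move=> mn; rewrite lef_pV2 ?posrE// ler_nat.
have bS m n : (m <= n)%N -> b m <= b n by move=> mn; rewrite ler_nat.
pose I n : set R := `[a n, b n]%classic.
pose J n : set R := `[H (a n), H (b n)]%classic.
have JO n : J n `<=` `]H 0, l[.
  move=> t; rewrite /J /= !in_itv/= => /andP[t1 t2].
  have := Hin _ (a0 n); have := Hin _ (b0 n); rewrite !in_itv/=.
  by move=> /andP[_ ?] /andP[? _]; apply/andP; split; lra.
have IO n : I n `<=` (`]0, +oo[%classic : set R).
  by move=> x; rewrite /I/= !in_itv/= andbT => /andP[+ _]; exact: lt_le_trans.
have JE : (`]H 0, l[%classic : set R) = \bigcup_n J n.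
  apply/seteqP; split=> t; last by move=> [n _ /JO].
  rewrite /= in_itv/= => /andP[t0 tl].
  have [n [n1 n2]] : exists n, H (a n) < t /\ t < H (b n).
    have lim1 : H (a n) @[n --> \oo] --> H 0.
      apply: (cvg_comp a H _ (cH 0)); exact: cvg_harmonic.
    have lim2 : H (b n) @[n --> \oo] --> l.
      apply: (cvg_comp b H _ limH).
      by have := @cvgr_idn R; rewrite -cvg_shiftS.
    near \oo => n; exists n; split; near: n.
      exact: (cvgr_lt _ lim1).
    exact: (cvgr_gt _ lim2).
  by exists n => //; rewrite /J /= in_itv/= !ltW.
have IE : (`]0, +oo[%classic : set R) = \bigcup_n I n.
  apply/seteqP; split=> x; last by move=> [n _ /IO].
  rewrite /= in_itv/= andbT => x0; near \oo => n; exists n => //.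
  rewrite /I /= in_itv/=; apply/andP; split; last first.
    by rewrite /b -natr1 -lerBlDr; near: n; exact: nbhs_infty_ger.
  rewrite /a -[x]invrK lef_pV2 ?posrE ?invr_gt0//.
  by rewrite -natr1 -lerBlDr; near: n; exact: nbhs_infty_ger.
have intJ : (\int[mu]_(t in J n) (G t)%:E @[n --> \oo] -->
    \int[mu]_(t in `]H 0%R, l[) (G t)%:E)%E.
  rewrite JE; apply: ge0_nondecreasing_set_cvg_integral.
  - move=> m n mn; apply/subsetPset => t; rewrite /J /= !in_itv/= => /andP[t1 t2].
    by rewrite (le_trans _ t1) ?incH' ?aS//= (le_trans t2) ?incH' ?bS.
  - by move=> n; exact: measurable_itv.
  - by move=> n; apply/measurable_EFinP; exact: measurable_funS (JO n) mG.
  - by move=> n t /JO tI; rewrite lee_fin G0.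
have intI : (\int[mu]_(x in I n) (G (H x) * dH x)%:E @[n --> \oo] -->
    \int[mu]_(x in `]0%R, +oo[) (G (H x) * dH x)%:E)%E.
  rewrite IE; apply: ge0_nondecreasing_set_cvg_integral.
  - move=> m n mn; apply/subsetPset => t; rewrite /I /= !in_itv/= => /andP[t1 t2].
    by rewrite (le_trans _ t1) ?aS//= (le_trans t2) ?bS.
  - by move=> n; exact: measurable_itv.
  - by move=> n; apply/measurable_EFinP; exact: measurable_funS (IO n) mGH.
  - move=> n t /IO /=; rewrite in_itv/= andbT => t0.
    by rewrite lee_fin mulr_ge0 ?dH0// G0// Hin.
have eIJ : forall n, (\int[mu]_(t in J n) (G t)%:E = \int[mu]_(x in I n) (G (H x) * dH x)%:E)%E.
  move=> n; rewrite (integration_by_substitution_increasing (ab n)) ?dHD//.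
  - move=> x y; rewrite !in_itv/= => /andP[ax _] /andP[ay _]; apply: incH.
      by rewrite in_itv/= andbT (le_trans _ ax)// ltW.
    by rewrite in_itv/= andbT (le_trans _ ay)// ltW.
  - by apply: cvgP; apply: cvg_at_right_filter; exact: cdH.
  - by apply: cvgP; apply: cvg_at_left_filter; exact: cdH.
  - split; first by move=> x _; exact: (@ex_derive _ _ _ _ _ _ _ (dHE x)).
      by apply: cvg_at_right_filter; exact: cH.
    by apply: cvg_at_left_filter; exact: cH.
  apply: continuous_in_subspaceT => t; rewrite inE => /JO; exact: cG.
have eIJf : (fun n => \int[mu]_(t in J n) (G t)%:E)%E
    = (fun n => \int[mu]_(x in I n) (G (H x) * dH x)%:E)%E.
  by apply/funext => n; exact: eIJ.
rewrite eIJf in intJ; exact: (cvg_unique _ intJ intI).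
Unshelve. all: by end_near.
Qed.

End Substitution.

(** * The map 2 tanh^2 - 1 *)

Section HalfRangeMap.
Context {R : realType}.
Local Notation mu := (@lebesgue_measure R).
Implicit Types x y t : R.

Lemma derive_gt0_lt (f df : R -> R) a : (forall x, is_derive x (1 : R) f (df x)) ->
  (forall x, a < x -> 0 < df x) -> {in `[a, +oo[ &, {homo f : x y / x < y}}.
Proof.
move=> fd df0 x y; rewrite !in_itv/= !andbT => ax ay xy.
apply: (@gtr0_derive1_incr _ f a y) => //.
- move=> z; rewrite in_itv/= => /andP[az _].
  by rewrite derive1E (@derive_val _ _ _ _ _ _ _ (fd z)) df0.
- exact/continuous_subspaceT/(derive_continuous fd).
Qed.

Definition hmap x : R := 2 * tanh x ^+ 2 - 1.
Definition dhmap x : R := 4 * tanh x * (1 - tanh x ^+ 2).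

Lemma hmap_dbl_sqr x : hmap x = dbl_sqr.[tanh x].
Proof. by rewrite /hmap /dbl_sqr hornerD hornerN hornerZ hornerXn hornerC. Qed.

Lemma hmap_cosh x : hmap x = 1 - 2 / cosh x ^+ 2.
Proof. by rewrite /hmap tanh2; field; rewrite cosh_neq0. Qed.

Lemma is_derive_hmap x : is_derive x (1 : R) hmap (dhmap x).
Proof.
have dt := is_derive_tanh x; rewrite /hmap /dhmap.
by apply: is_derive_eq; rewrite /GRing.scale/=; ring.
Qed.

Lemma dhmap_continuous : continuous dhmap.
Proof.
have d x : is_derive x (1 : R) dhmap
    (4 * (1 - tanh x ^+ 2) * (1 - 3 * tanh x ^+ 2)).
  have dt := is_derive_tanh x; rewrite /dhmap.
  by apply: is_derive_eq; rewrite /GRing.scale/=; ring.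
exact: derive_continuous d.
Qed.

Lemma one_sub_tanh2_gt0 x : 0 < 1 - tanh x ^+ 2.
Proof. by rewrite tanh2 opprB addrC subrK invr_gt0 exprn_gt0// cosh_gt0. Qed.

Lemma dhmap_gt0 x : 0 < x -> 0 < dhmap x.
Proof.
by move=> x0; rewrite mulr_gt0 ?one_sub_tanh2_gt0// mulr_gt0// tanh_gt0.
Qed.

Lemma hmap_lt1 x : hmap x < 1.
Proof. by have := one_sub_tanh2_gt0 x; rewrite /hmap; lra. Qed.

Lemma hmapN x : hmap (- x) = hmap x.
Proof. by rewrite /hmap tanhN sqrrN. Qed.

Lemma hmap0 : hmap 0 = -1 :> R.
Proof. by rewrite /hmap tanh0 expr0n/= mulr0 sub0r. Qed.

Lemma hmap_incr : {in `[0, +oo[ &, {homo hmap : x y / x < y}}.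
Proof. exact: derive_gt0_lt is_derive_hmap dhmap_gt0. Qed.

Lemma hmap_gtN1 x : 0 < x -> -1 < hmap x.
Proof.
by move=> x0; rewrite /hmap; have := exprn_gt0 2 (tanh_gt0 x0); lra.
Qed.

Lemma hmap_cvg1 : hmap x @[x --> +oo] --> (1 : R).
Proof.
have -> : hmap = (fun x => 1 - 2 * gauge 2 x).
  apply/funext => x; rewrite hmap_cosh /gauge -[X in cosh x `^ X]/(2%:R).
  by rewrite powR_mulrn// ltW// cosh_gt0.
rewrite -[X in _ --> X](subr0 1) -(mulr0 2); apply: cvgB; first exact: cvg_cst.
by apply: cvgM; [exact: cvg_cst | exact: gauge_cvg0].
Qed.

Lemma ge0_half_range_substitution (G f : R -> R) :
  {in `]-1, 1[, continuous G} -> {in `]-1, 1[, forall t, 0 <= G t} ->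
  continuous f -> (forall x, 0 <= f x) -> (forall x, f (- x) = f x) ->
  (forall x, 0 < x -> G (hmap x) * dhmap x = 2 * f x) ->
  (\int[mu]_(t in `](-1)%R, 1%R[) (G t)%:E = \int[mu]_x (f x)%:E)%E.
Proof.
move=> cG G0 cf f0 fN Gf.
have mf : measurable_fun [set: R] f by exact: continuous_measurable_fun.
rewrite -hmap0 (ge0_substitution_ray is_derive_hmap)//; first last.
- by rewrite hmap0.
- by rewrite hmap0.
- exact: hmap_cvg1.
- by move=> x _; exact: hmap_lt1.
- exact: hmap_incr.
- by move=> x /dhmap_gt0/ltW.
- exact: dhmap_continuous.
rewrite ge0_symfun_integralT//; last by move=> x; rewrite /= fN.
rewrite -set_itvcy -ge0_integralZl//; last 2 first.
- by apply/measurable_EFinP; exact: measurable_funTS.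
- by move=> x _; rewrite lee_fin.
rewrite -integral_itv_obnd_cbnd; last first.
  by apply/measurable_EFinP; apply: measurable_funM => //; exact: measurable_funTS.
apply: eq_integral => x; rewrite inE/= in_itv/= andbT => x0.
by rewrite Gf.
Qed.

(** The signed case follows from the nonnegative one applied to [`|G|] and to
    [`|G| + G]. *)
Lemma half_range_substitution (G f : R -> R) :
  {in `]-1, 1[, continuous G} -> continuous f ->
  mu.-integrable [set: R] (EFin \o f) -> (forall x, f (- x) = f x) ->
  (forall x, 0 < x -> G (hmap x) * dhmap x = 2 * f x) ->
  mu.-integrable (`]-1, 1[%classic : set R) (EFin \o G) /\
  \int[mu]_(t in `]-1, 1[) G t = \int[mu]_x f x.
Proof.
move=> cG cf intf fN Gf.
have mG : measurable_fun (`]-1, 1[%classic : set R) G.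
  apply: open_continuous_measurable_fun; first exact: interval_open.
  by move=> t; rewrite inE/=; exact: cG.
have cnorm (g : R -> R) x : {for x, continuous g} -> {for x, continuous (fun y => `|g y|)}.
  by move=> cg; apply: (continuous_comp cg); exact: norm_continuous.
have GfA x : 0 < x -> `|G (hmap x)| * dhmap x = 2 * `|f x|.
  move=> x0; rewrite -[dhmap x]ger0_norm ?ltW ?dhmap_gt0// -normrM Gf// normrM.
  by rewrite ger0_norm.
have eA : (\int[mu]_(t in `](-1)%R, 1%R[) `|G t|%:E = \int[mu]_x `|f x|%:E)%E.
  apply: ge0_half_range_substitution => //.
  - by move=> t tI; apply: cnorm; exact: cG.
  - by move=> x; apply: cnorm; exact: cf.
  - by move=> x; rewrite fN.
have eS : (\int[mu]_(t in `](-1)%R, 1%R[) (`|G t| + G t)%:E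
    = \int[mu]_x (`|f x| + f x)%:E)%E.
  apply: ge0_half_range_substitution => //.
  - by move=> t tI; apply: cvgD; [apply: cnorm|]; exact: cG.
  - by move=> t _; rewrite -lerBlDr sub0r -normrN ler_norm.
  - by move=> x; apply: cvgD; [apply: cnorm|]; exact: cf.
  - by move=> x; rewrite -lerBlDr sub0r -normrN ler_norm.
  - by move=> x; rewrite fN.
  - by move=> x x0; rewrite mulrDl GfA// Gf// mulrDr.
have intG : mu.-integrable (`]-1, 1[%classic : set R) (EFin \o G).
  apply/integrableP; split; first exact/measurable_EFinP.
  rewrite [ltLHS]eA; by case/integrableP : intf.
split=> //.
have mI : measurable (`]-1, 1[%classic : set R) by exact: measurable_itv.
have intGA : mu.-integrable (`]-1, 1[%classic : set R) (EFin \o (fun t => `|G t|)).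
  exact: integrable_abse intG.
have intfA : mu.-integrable [set: R] (EFin \o (fun t => `|f t|)).
  exact: integrable_abse intf.
have -> : \int[mu]_(t in `]-1, 1[) G t =
    \int[mu]_(t in `]-1, 1[) (`|G t| + G t) - \int[mu]_(t in `]-1, 1[) `|G t|.
  by rewrite RintegralD//; ring.
rewrite /Rintegral eA eS -!/(Rintegral _ _ _) RintegralD//; ring.
Qed.

End HalfRangeMap.

(** * The Jacobi weights in the variable x *)

Section JacobiWeight.
Context {R : realType}.
Local Notation mu := (@lebesgue_measure R).
Local Notation Iab := (`]-1, 1[%classic : set R).
Implicit Types al be p x t : R.

Definition jacobi_weight al be t : R := (1 - t) `^ al * (1 + t) `^ be.

Lemma jacobi_weight_gt0 al be t : t \in `]-1, 1[ -> 0 < jacobi_weight al be t.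
Proof.
rewrite in_itv/= => /andP[t1 t2].
by rewrite mulr_gt0// powR_gt0 //; lra.
Qed.

Lemma jacobi_weight_continuous al be : {in `]-1, 1[, continuous (jacobi_weight al be)}.
Proof.
move=> t; rewrite in_itv/= => /andP[t1 t2].
have p1 : 0 < 1 - t by lra.
have p2 : 0 < 1 + t by lra.
have d1 : is_derive t (1 : R) (fun t => 1 - t) (-1).
  by apply: is_derive_eq; ring.
have d2 : is_derive t (1 : R) (fun t => 1 + t) 1.
  by apply: is_derive_eq; ring.
have d := is_deriveM
  (is_derive1_comp (g := fun t => 1 - t) (is_derive1_powR al p1) d1)
  (is_derive1_comp (g := fun t => 1 + t) (is_derive1_powR be p2) d2).
apply/differentiable_continuous/derivable1_diffP.
exact: (@ex_derive _ _ _ _ _ _ _ d).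
Qed.

Lemma powR_expR (z w : R) : expR z `^ w = expR (w * z).
Proof. by rewrite /powR gt_eqF ?expR_gt0// expRK. Qed.

Definition even_const al : R := 2 `^ ((2 * al + 1) / 4).
Definition odd_const al : R := 2 `^ ((2 * al + 3) / 4).

(* All three factors are monomials in 2, cosh x and tanh x, so that identities
   between their real powers become linear in the logarithms. *)
Let weight_expR al be x : 0 < x ->
  jacobi_weight al be (hmap x) * dhmap x =
  expR (al * (ln 2 - 2 * ln (cosh x)) + be * (ln 2 + 2 * ln (tanh x))
    + (2 * ln 2 + ln (tanh x) - 2 * ln (cosh x))).
Proof.
move=> x0; have u0 := cosh_gt0 x; have v0 := tanh_gt0 x0.
have e1 : 1 - hmap x = expR (ln 2 - 2 * ln (cosh x)).
  rewrite expRB expRM_natl !lnK ?posrE// hmap_cosh.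
  by rewrite opprB addrC subrK.
have e2 : 1 + hmap x = expR (ln 2 + 2 * ln (tanh x)).
  by rewrite expRD expRM_natl !lnK ?posrE// /hmap; ring.
have e3 : dhmap x = expR (2 * ln 2 + ln (tanh x) - 2 * ln (cosh x)).
  rewrite expRB expRD !expRM_natl !lnK ?posrE// /dhmap tanh2.
  by field; rewrite cosh_neq0.
by rewrite /jacobi_weight e1 e2 e3 !powR_expR -!expRD.
Qed.

Let const_expR (w : R) : 2 `^ w = expR (w * ln 2) :> R.
Proof. by rewrite /powR gt_eqF. Qed.

(** The right side is twice the squared prefactor of the even functions
    [psi al]: the factor 2 accounts for the two half-lines. *)
Lemma jacobi_weight_even al x : 0 < x ->
  jacobi_weight al (- 2^-1) (hmap x) * dhmap x
  = 2 * (even_const al * gauge (1 + al) x) ^+ 2.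
Proof.
move=> x0; rewrite weight_expR// /even_const const_expR gaugeE -expRD -expRM_natl.
by rewrite -[X in _ = X * _](@lnK _ 2) ?posrE// -expRD; congr expR; field.
Qed.

Lemma jacobi_weight_odd al x : 0 < x ->
  jacobi_weight al 2^-1 (hmap x) * dhmap x
  = 2 * (odd_const al * (tanh x * gauge (1 + al) x)) ^+ 2.
Proof.
move=> x0; rewrite weight_expR// /odd_const const_expR gaugeE.
rewrite -[X in (_ * (X * _)) ^+ 2](@lnK _ (tanh x)) ?posrE ?tanh_gt0//.
rewrite -!expRD -expRM_natl.
by rewrite -[X in _ = X * _](@lnK _ 2) ?posrE// -expRD; congr expR; field.
Qed.

Let weighted_integral al be k (U V : {poly R}) : -1 < al ->
  (forall x, 0 < x -> jacobi_weight al be (hmap x) * dhmap x * (U \Po dbl_sqr).[tanh x]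
    = 2 * (k * (gauge (2 * (1 + al)) x * V.[tanh x]))) ->
  V \Po - 'X = V ->
  mu.-integrable Iab (EFin \o (fun t => U.[t] * jacobi_weight al be t)) /\
  \int[mu]_(t in Iab) (U.[t] * jacobi_weight al be t)
    = k * gauge_integral (1 + al) V.
Proof.
move=> al1 weight_eq VN.
have p2 : 0 < 2 * (1 + al) by lra.
have iV := integrable_gauge_poly V p2.
have [] := @half_range_substitution _ (fun t => U.[t] * jacobi_weight al be t)
  (fun x => k * (gauge (2 * (1 + al)) x * V.[tanh x])).
- move=> t tI; apply: continuousM; first exact: continuous_horner.
  exact: jacobi_weight_continuous.
- move=> x; apply: cvgM; [exact: cvg_cst | exact: gauge_poly_continuous].
- exact: (integrableZl measurableT _ iV).
- by move=> x; rewrite gaugeN tanhN -[in RHS]VN horner_comp hornerN hornerX.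
- move=> x x0; rewrite -weight_eq// horner_comp -hmap_dbl_sqr; ring.
by move=> iG ->; split=> //; rewrite RintegralZl.
Qed.

Lemma jacobi_integral_even al (U : {poly R}) : -1 < al ->
  mu.-integrable Iab (EFin \o (fun t => U.[t] * jacobi_weight al (- 2^-1) t)) /\
  \int[mu]_(t in Iab) (U.[t] * jacobi_weight al (- 2^-1) t)
    = even_const al ^+ 2 * gauge_integral (1 + al) (U \Po dbl_sqr).
Proof.
move=> al1; apply: weighted_integral => //.
  by move=> x x0; rewrite jacobi_weight_even// -gauge_sqr; ring.
rewrite -comp_polyA; congr (_ \Po _).
by rewrite /dbl_sqr comp_polyB comp_polyZ comp_Xn_poly comp_polyC sqrrN.
Qed.

Lemma jacobi_integral_odd al (U : {poly R}) : -1 < al ->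
  mu.-integrable Iab (EFin \o (fun t => U.[t] * jacobi_weight al 2^-1 t)) /\
  \int[mu]_(t in Iab) (U.[t] * jacobi_weight al 2^-1 t)
    = odd_const al ^+ 2 * gauge_integral (1 + al) ('X^2 * (U \Po dbl_sqr)).
Proof.
move=> al1; apply: weighted_integral => //.
  move=> x x0; rewrite jacobi_weight_odd// -gauge_sqr hornerM hornerXn; ring.
rewrite comp_polyM comp_Xn_poly sqrrN -comp_polyA; congr (_ * (_ \Po _)).
by rewrite /dbl_sqr comp_polyB comp_polyZ comp_Xn_poly comp_polyC sqrrN.
Qed.

End JacobiWeight.

(** * The systems psi are orthonormal and tridiagonal *)

Section PsiSystem.
Context {R : realType}.
Local Notation mu := (@lebesgue_measure R).
Local Notation Iab := (`]-1, 1[%classic : set R).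
Variable al : R.
Hypothesis al_gt : -1 < al.
Local Notation p := (1 + al).
Local Notation L := (gauge_integral p).
Implicit Types (x t : R) (m n : nat).

Let p_gt0 : 0 < p. Proof. by rewrite addrC -ltrBlDr sub0r. Qed.

Let half_gt : -1 < 2^-1 :> R.
Proof. by apply: (lt_trans (ltrN10 _)); rewrite invr_gt0. Qed.
Let Nhalf_gt : -1 < - 2^-1 :> R.
Proof. by rewrite ltrN2 invf_lt1// ltr1n. Qed.

Let Leven m := jacobi al (- 2^-1) m \Po dbl_sqr.
Let Lodd m := 'X * (jacobi al 2^-1 m \Po dbl_sqr).

Let even_coef m := even_const al / Num.sqrt (jacobi_sqnorm al (- 2^-1) m).
Let odd_coef m := odd_const al / Num.sqrt (jacobi_sqnorm al 2^-1 m).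

(** The normalised Gegenbauer polynomials, with the sign [(-1)^n] in front of
    the leading coefficient. *)
Definition psi_poly n : {poly R} :=
  if odd n then - odd_coef n./2 *: Lodd n./2 else even_coef n./2 *: Leven n./2.

Lemma psi_gauge n x : psi al n x = gauge p x * (psi_poly n).[tanh x].
Proof.
rewrite /psi /psi_poly; case: ifP => _.
  rewrite /psi_odd hornerZ /Lodd hornerM hornerX horner_comp -hmap_dbl_sqr hmap_cosh.
  have -> : sinh x / cosh x `^ (2 + al) = tanh x * gauge p x.
    rewrite (_ : 2 + al = 1 + p); last by ring.
    rewrite powRD; last by rewrite cosh_neq0 implybT.
    by rewrite powRr1 ?(ltW (cosh_gt0 x))// invfM mulrA.
  by rewrite /odd_coef /odd_const; ring.
rewrite /psi_even hornerZ /Leven horner_comp -hmap_dbl_sqr hmap_cosh.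
by rewrite /even_coef /even_const /gauge; ring.
Qed.

Let jacobi_neq0 be m : -1 < be -> jacobi al be m != 0.
Proof.
by move=> be1; have [s _] := size_jacobi m al_gt be1; rewrite -size_poly_eq0 s.
Qed.

Let size_dbl_sqr_gt1 : (1 < size (dbl_sqr : {poly R}))%N.
Proof. by rewrite size_dbl_sqr. Qed.

Let Leven_neq0 m : Leven m != 0.
Proof. by rewrite /Leven comp_poly_eq0// jacobi_neq0. Qed.

Let Lodd_neq0 m : Lodd m != 0.
Proof. by rewrite /Lodd mulf_neq0 ?polyX_eq0// comp_poly_eq0// jacobi_neq0. Qed.

Let const_gt0 w : 0 < 2 `^ w :> R. Proof. by rewrite powR_gt0. Qed.

Lemma jacobi_sqnorm_even m :
  jacobi_sqnorm al (- 2^-1) m = even_const al ^+ 2 * L (Leven m ^+ 2).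
Proof.
have [_] := jacobi_integral_even (jacobi al (- 2^-1) m * jacobi al (- 2^-1) m) al_gt.
rewrite comp_polyM -expr2 => <-; apply: eq_Rintegral => t _.
by rewrite hornerM mulrC expr2.
Qed.

Lemma jacobi_sqnorm_odd m :
  jacobi_sqnorm al 2^-1 m = odd_const al ^+ 2 * L (Lodd m ^+ 2).
Proof.
have [_] := jacobi_integral_odd (jacobi al 2^-1 m * jacobi al 2^-1 m) al_gt.
rewrite /Lodd exprMn comp_polyM -expr2 => <-; apply: eq_Rintegral => t _.
by rewrite hornerM mulrC expr2.
Qed.

Lemma jacobi_sqnorm_even_gt0 m : 0 < jacobi_sqnorm al (- 2^-1) m.
Proof.
by rewrite jacobi_sqnorm_even mulr_gt0 ?exprn_gt0 ?const_gt0// gauge_integral_sqr_gt0.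
Qed.

Lemma jacobi_sqnorm_odd_gt0 m : 0 < jacobi_sqnorm al 2^-1 m.
Proof.
by rewrite jacobi_sqnorm_odd mulr_gt0 ?exprn_gt0 ?const_gt0// gauge_integral_sqr_gt0.
Qed.

Let even_coef_gt0 m : 0 < even_coef m.
Proof. by rewrite divr_gt0 ?const_gt0// sqrtr_gt0 jacobi_sqnorm_even_gt0. Qed.

Let odd_coef_gt0 m : 0 < odd_coef m.
Proof. by rewrite divr_gt0 ?const_gt0// sqrtr_gt0 jacobi_sqnorm_odd_gt0. Qed.

Let LZ a F : L (a *: F) = a * L F.
Proof.
have L_lin := gauge_integral_linear _ _ _ p_gt0.
have L0 : L 0 = 0.
  by have := L_lin 1 0 0; rewrite scaler0 addr0 mul1r; lra.
by have := L_lin a F 0; rewrite L0 !addr0.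
Qed.

Lemma psi_poly_gegenbauer n :
  gegenbauer_op p (psi_poly n) = - (n%:R * (n%:R + 2 * p - 1)) *: psi_poly n.
Proof.
have opZ a F : gegenbauer_op p (a *: F) = a *: gegenbauer_op p F.
  rewrite /gegenbauer_op !derivZ -!scalerAr scalerBr; congr (_ - _).
  by rewrite !scalerA mulrC.
have n2 := odd_double_half n; rewrite /psi_poly; case: ifP n2 => _ /=.
  by rewrite add1n; move: n./2 => k <-; rewrite opZ gegenbauer_odd !scalerA mulrC.
by rewrite add0n; move: n./2 => k <-; rewrite opZ gegenbauer_even !scalerA mulrC.
Qed.

(** Off the diagonal, the eigenvalues [n (n + 2 p - 1)] are distinct for
    [p > 0]; on the diagonal, [jacobi_sqnorm] is the same integral seen in the
    variable [2 tanh^2 - 1]. *)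
Lemma psi_poly_orthonormal m n : L (psi_poly m * psi_poly n) = (m == n)%:R.
Proof.
have [<-|mn] := eqVneq m n; last first.
  apply: (gegenbauer_eigen_orthogonal _ _ (psi_poly_gegenbauer m) (psi_poly_gegenbauer n)).
  - by move=> a F G; exact: gauge_integral_linear.
  - by move=> F; exact: gauge_integral_pearson.
  rewrite eqr_opp -subr_eq0.
  rewrite (_ : _ - _ = (m%:R - n%:R) * ((m + n)%:R + 2 * p - 1)); last first.
    by rewrite natrD; ring.
  rewrite mulf_neq0// ?subr_eq0 ?eqr_nat//.
  have : 1 <= (m + n)%:R :> R.
    by rewrite ler1n addn_gt0; case: (m) (n) mn => [|?] [|?].
  move: p_gt0 => q0 mn1; apply/eqP; lra.
have coefE k g l : g = k ^+ 2 * l -> 0 < g -> (k / Num.sqrt g) ^+ 2 * l = 1.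
  move=> gE g0; rewrite expr_div_n sqr_sqrtr ?(ltW g0)// mulrAC -gE.
  by rewrite divff// gt_eqF.
rewrite /psi_poly; case: ifP => _.
  rewrite scaleNr mulrNN -scalerAl -scalerAr !LZ mulrA -!expr2.
  by rewrite coefE ?jacobi_sqnorm_odd_gt0// jacobi_sqnorm_odd.
rewrite -scalerAl -scalerAr !LZ mulrA -!expr2.
by rewrite coefE ?jacobi_sqnorm_even_gt0// jacobi_sqnorm_even.
Qed.

Let size_comp_dbl_sqr be m : -1 < be ->
  size (jacobi al be m \Po dbl_sqr) = m.*2.+1 /\
  0 < lead_coef (jacobi al be m \Po dbl_sqr).
Proof.
move=> be1; have [sJ lJ] := size_jacobi m al_gt be1; split.
  have := size_comp_poly (jacobi al be m) dbl_sqr.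
  rewrite sJ size_dbl_sqr /= muln2 => <-; rewrite prednK// size_poly_gt0.
  by rewrite comp_poly_eq0// jacobi_neq0.
by rewrite lead_coef_comp// lead_coef_dbl_sqr mulr_gt0// exprn_gt0.
Qed.

Lemma psi_poly_size n : size (psi_poly n) = n.+1.
Proof.
have n2 := odd_double_half n; rewrite /psi_poly; case: ifP n2 => _ /= n2.
  rewrite size_scale ?oppr_eq0 ?gt_eqF// /Lodd mulrC size_mulX ?comp_poly_eq0 ?jacobi_neq0//.
  by have [-> _] := size_comp_dbl_sqr n./2 half_gt; rewrite -[X in _ = X.+1]n2.
rewrite size_scale ?gt_eqF// /Leven.
by have [-> _] := size_comp_dbl_sqr n./2 Nhalf_gt; rewrite -[X in _ = X.+1]n2.
Qed.

Lemma psi_poly_sign n : lead_coef (psi_poly n) * lead_coef (psi_poly n.+1) < 0.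
Proof.
have neg k : odd k -> lead_coef (psi_poly k) < 0.
  move=> ok; rewrite /psi_poly ok lead_coefZ mulNr oppr_lt0 mulr_gt0//.
  rewrite /Lodd mulrC lead_coefMX.
  by have [_] := size_comp_dbl_sqr k./2 half_gt.
have pos k : ~~ odd k -> 0 < lead_coef (psi_poly k).
  move=> /negPf ok; rewrite /psi_poly ok lead_coefZ mulr_gt0//.
  by have [_] := size_comp_dbl_sqr k./2 Nhalf_gt.
have [on|en] := boolP (odd n).
  by rewrite nmulr_rlt0 ?neg ?pos//= on.
by rewrite pmulr_rlt0 ?neg ?pos//=.
Qed.

Lemma psi_tridiagonal : tridiagonal_skew_differentiation (psi al).
Proof.
have [b [b0 bE]] := @ladder_tridiagonal R p L
  (fun a F G => gauge_integral_linear a F G p_gt0)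
  (fun F => gauge_integral_pearson F p_gt0) psi_poly
  psi_poly_size psi_poly_orthonormal p_gt0 psi_poly_sign.
exists b; split=> // m x.
rewrite (_ : psi al m = fun y => gauge p y * (psi_poly m).[tanh y]); last first.
  by apply/funext => y; rewrite psi_gauge.
apply: (is_derive_eq (is_derive_gauge_poly p (psi_poly m) x)).
rewrite bE hornerD hornerN hornerZ psi_gauge mulrBr; congr (_ - _); first ring.
by case: m => [|m]; rewrite ?horner0 ?mulr0// hornerZ psi_gauge; ring.
Qed.

Let psi_mulE m n x : psi al m x * psi al n x
  = gauge (2 * p) x * (psi_poly m * psi_poly n).[tanh x].
Proof. by rewrite !psi_gauge -gauge_sqr hornerM; ring. Qed.

Lemma psi_continuous n : continuous (psi al n).
Proof.
rewrite (_ : psi al n = fun y => gauge p y * (psi_poly n).[tanh y]).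
  exact: gauge_poly_continuous.
by apply/funext => y; rewrite psi_gauge.
Qed.

Lemma psi_orthonormal : orthonormal_L2 (psi al).
Proof.
have p2 : 0 < 2 * p by rewrite mulr_gt0.
split=> m; last first.
  move=> n; rewrite -psi_poly_orthonormal; apply: eq_Rintegral => x _.
  exact: psi_mulE.
have mf : measurable_fun [set: R] (psi al m).
  apply: continuous_measurable_fun; exact: psi_continuous.
rewrite inE/=; apply/andP; split; rewrite inE//= /finite_norm unlock.
rewrite poweR_lty//.
have /integrableP[_] := integrable_gauge_poly (psi_poly m * psi_poly m) p2.
apply: le_lt_trans; rewrite le_eqVlt; apply/orP; left; apply/eqP.
apply: eq_integral => x _ /=.
by rewrite -psi_mulE powR_mulrn// -normrX expr2.
Qed.

End PsiSystem.

(** * The systems psi have half-range form *)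

Section HalfRangeForm.
Context {R : realType}.
Local Notation mu := (@lebesgue_measure R).
Local Notation Iab := (`]-1, 1[%classic : set R).
Implicit Types al x t s : R.

Lemma artanh_gt0 s : 0 < s < 1 -> 0 < artanh s.
Proof.
move=> /andP[s0 s1]; rewrite divr_gt0// ln_gt0// ltr_pdivlMr; lra.
Qed.

Lemma artanhK s : 0 < s < 1 -> tanh (artanh s) = s.
Proof.
move=> /andP[s0 s1].
have q0 : 0 < (1 + s) / (1 - s) by rewrite divr_gt0; lra.
have e2 : expR (artanh s) ^+ 2 = (1 + s) / (1 - s).
  by rewrite -expRM_natl /artanh mulrC divfK// lnK.
have E0 := expR_gt0 (artanh s); rewrite /tanh /sinh /cosh expRN.
set E := expR _ in e2 E0 *.
transitivity ((E ^+ 2 - 1) / (E ^+ 2 + 1)).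
  field; have := exprn_gt0 2 E0 => h; do ?[apply/andP; split]; rewrite gt_eqF//; lra.
by rewrite e2; field; do ?[apply/andP; split]; apply/eqP; lra.
Qed.

(** The inverse of [hmap] on the positive half-line. *)
Definition hinv t : R := artanh (Num.sqrt ((1 + t) / 2)).

Lemma hmapK x : 0 < x -> hinv (hmap x) = x.
Proof.
move=> x0; rewrite /hinv /hmap (_ : _ / 2 = tanh x ^+ 2); last by field.
by rewrite sqrtr_sqr gtr0_norm ?tanh_gt0// tanhK.
Qed.

Let sqrt_itv t : t \in `]-1, 1[ -> 0 < Num.sqrt ((1 + t) / 2) < 1.
Proof.
rewrite in_itv/= => /andP[t1 t2]; rewrite sqrtr_gt0; apply/andP; split; first lra.
by rewrite -[ltRHS]sqrtr1 ltr_sqrt//; lra.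
Qed.

Lemma hinv_gt0 t : t \in `]-1, 1[ -> 0 < hinv t.
Proof. by move=> /sqrt_itv; exact: artanh_gt0. Qed.

Lemma hinvK t : t \in `]-1, 1[ -> hmap (hinv t) = t.
Proof.
move=> tI; rewrite /hmap /hinv artanhK ?sqrt_itv// sqr_sqrtr; first by field.
by move: tI; rewrite in_itv/=; lra.
Qed.

Lemma hmap_itv x : 0 < x -> hmap x \in `]-1, 1[.
Proof. by move=> x0; rewrite in_itv/= hmap_gtN1// hmap_lt1. Qed.

Lemma is_derive_hinv t : t \in `]-1, 1[ ->
  is_derive t (1 : R) hinv (dhmap (hinv t))^-1.
Proof.
move=> tI; have x0 := hinv_gt0 tI; rewrite -{1}(hinvK tI).
apply: is_derive_inverse.
- near=> x; apply: hmapK; near: x; exact: lt_nbhsr.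
- by near=> x; exact: (derive_continuous (@is_derive_hmap R)).
- exact: is_derive_hmap.
- by rewrite gt_eqF// dhmap_gt0.
Unshelve. all: by end_near. Qed.

Lemma derive1_hinv t : t \in `]-1, 1[ -> derive1 hinv t = (dhmap (hinv t))^-1.
Proof.
by move=> tI; rewrite derive1E (@derive_val _ _ _ _ _ _ _ (is_derive_hinv tI)).
Qed.

Lemma derive1_hmap x : derive1 hmap x = dhmap x.
Proof. by rewrite derive1E (@derive_val _ _ _ _ _ _ _ (is_derive_hmap x)). Qed.

Lemma hmap_half_range_change : half_range_change hinv (@hmap R).
Proof.
split.
- apply/seteqP; split=> [x [t tI <-]|x] /=.
    by rewrite in_itv/= andbT hinv_gt0.
  rewrite in_itv/= andbT => x0; exists (hmap x); last exact: hmapK.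
  exact: hmap_itv.
- move=> t /set_mem tI; exact: (@ex_derive _ _ _ _ _ _ _ (is_derive_hinv tI)).
- apply: (@eq_measurable_fun _ _ _ _ _ (fun t => (dhmap (hinv t))^-1)).
    by move=> t /set_mem tI; rewrite derive1_hinv.
  apply: open_continuous_measurable_fun; first exact: interval_open.
  move=> t /set_mem tI; apply: cvgV.
    by rewrite gt_eqF// dhmap_gt0// hinv_gt0.
  apply: (@continuous_comp _ _ _ hinv dhmap); last exact: dhmap_continuous.
  apply/differentiable_continuous/derivable1_diffP.
  exact: (@ex_derive _ _ _ _ _ _ _ (is_derive_hinv tI)).
- by move=> t /set_mem tI; rewrite derive1_hinv// invr_gt0 dhmap_gt0// hinv_gt0.
- by move=> t /set_mem tI; exact: hinvK.
- by move=> x _; exact: (@ex_derive _ _ _ _ _ _ _ (is_derive_hmap x)).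
- move=> t /set_mem tI; rewrite derive1_hinv// derive1_hmap mulVf//.
  by rewrite gt_eqF// dhmap_gt0// hinv_gt0.
- exact: hmapN.
- exact: hmap0.
Qed.

Lemma cst_restrict_Loo (c : R) (A : set R) : measurable A ->
  (cst c : R -> R) \_ A \in Lfun mu +oo%E.
Proof.
move=> mA; rewrite inE/=; apply/andP; split; rewrite inE//=.
  have mc : measurable_fun A (cst c : R -> R) by exact: measurable_cst.
  exact: (measurable_restrictT (cst c : R -> R) mA).1 mc.
rewrite /finite_norm unlock/=; case: ifP => // _.
apply: (@le_lt_trans _ _ `|c|%:E); last exact: ltry.
apply/ess_supP; apply: nearW => x /=; rewrite lee_fin patchE.
by case: ifP => // _; rewrite normr0.
Qed.

(** For a prefactor [Th] of constant sign [sg] on the positive half-line, the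
    relation between [w] and [Th] leaves no choice for the multiplier in
    [Th x = theta (H x) * H' x * w (H x)], and [theta * sqrt (w / h')] is then
    the constant [sg * sqrt 2 / 2]. *)
Section Multiplier.
Variables (w Th : R -> R) (sg : R).
Hypothesis w_Th : forall x, 0 < x -> w (hmap x) * dhmap x = 2 * Th x ^+ 2.
Hypothesis Th_sg : forall x, 0 < x -> Th x = sg * `|Th x|.
Hypothesis Th_neq0 : forall x, 0 < x -> Th x != 0.

Definition multiplier t : R := (2 * Th (hinv t))^-1.

Lemma multiplier_Theta x : 0 < x ->
  Th x = multiplier (hmap x) * derive1 hmap x * w (hmap x).
Proof.
move=> x0; rewrite /multiplier hmapK// derive1_hmap -mulrA [_ * w _]mulrC w_Th//.
by field; exact: Th_neq0.
Qed.

Lemma multiplier_bounded : sg ^+ 2 = 1 -> bounded_multiplier multiplier w hinv.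
Proof.
move=> sg2; rewrite /bounded_multiplier.
rewrite (_ : _ \_ _ = (cst (sg * Num.sqrt 2 / 2) : R -> R) \_ Iab).
  by apply: cst_restrict_Loo; exact: measurable_itv.
apply/funext => t; rewrite !patchE; case: ifP => // /set_mem tI.
have x0 := hinv_gt0 tI.
rewrite derive1_hinv// invrK -{2}(hinvK tI) w_Th// sqrtrM// sqrtr_sqr /multiplier /=.
have := Th_neq0 x0; have := Th_sg x0; set y := Th _ => -> y0.
have sg0 : sg != 0 by apply: contra_eq_neq sg2 => ->; rewrite expr0n/= eq_sym oner_eq0.
have yn0 : `|y| != 0 by move: y0; rewrite mulf_eq0 negb_or => /andP[].
rewrite normrM (_ : `|sg| = 1); last first.
  by apply/eqP; rewrite -(@eqrXn2 _ 2)// expr1n -normrX sg2 normr1.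
have sgV : sg^-1 = sg by apply: (mulfI sg0); rewrite divff// -expr2.
rewrite mul1r normr_id -[in RHS]sgV; field; by rewrite sg0.
Qed.

End Multiplier.

Section PsiHalfRange.
Variable al : R.
Hypothesis al_gt : -1 < al.

Let ThE x := even_const al * gauge (1 + al) x.
Let ThO x := - (odd_const al * (tanh x * gauge (1 + al) x)).
Let rE m := (Num.sqrt (jacobi_sqnorm al (- 2^-1) m))^-1 *: jacobi al (- 2^-1) m.
Let rO m := (Num.sqrt (jacobi_sqnorm al 2^-1 m))^-1 *: jacobi al 2^-1 m.

Let ThE_gt0 x : 0 < ThE x.
Proof. by rewrite mulr_gt0 ?gauge_gt0 ?powR_gt0. Qed.

Let ThO_lt0 x : 0 < x -> ThO x < 0.
Proof.
by move=> x0; rewrite oppr_lt0 mulr_gt0 ?powR_gt0// mulr_gt0 ?gauge_gt0// tanh_gt0.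
Qed.

Let psi_even_E m x : psi al m.*2 x = ThE x * (rE m).[hmap x].
Proof.
rewrite /psi odd_double doubleK /psi_even /rE hornerZ hmap_cosh /ThE /gauge /even_const.
by ring.
Qed.

Let psi_odd_E m x : psi al m.*2.+1 x = ThO x * (rO m).[hmap x].
Proof.
rewrite psi_gauge /psi_poly /= odd_double /= uphalf_double hornerZ hornerM hornerX.
by rewrite horner_comp -hmap_dbl_sqr /rO hornerZ /ThO /odd_const; ring.
Qed.

Lemma is_density_jacobi_weight be : is_density (@jacobi_weight R al be).
Proof.
split; last by move=> t /set_mem tI; rewrite ltW// jacobi_weight_gt0.
apply: open_continuous_measurable_fun; first exact: interval_open.
move=> t /set_mem; exact: jacobi_weight_continuous.
Qed.

(** Orthonormality on (-1, 1) is orthonormality of the functions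
    [psi al (k + 2 m)] on the line, pulled back by [hmap]; [k] is the common
    parity, and products of two functions of equal parity are even. *)
Lemma jacobi_orthonormal (be : R) (Th : R -> R) (p : nat -> {poly R}) k :
  -1 < be -> (forall m, 0 < jacobi_sqnorm al be m) ->
  (forall m, p m = (Num.sqrt (jacobi_sqnorm al be m))^-1 *: jacobi al be m) ->
  (forall x, 0 < x -> jacobi_weight al be (hmap x) * dhmap x = 2 * Th x ^+ 2) ->
  (forall x, Th (- x) = (-1) ^+ k * Th x) ->
  (forall m x, psi al (k + m.*2) x = Th x * (p m).[hmap x]) ->
  orthonormal_polynomials (jacobi_weight al be) p.
Proof.
move=> be1 g0 pE w_Th ThN psiE; split=> [m|m n].
  rewrite pE size_scale ?invr_eq0 ?gt_eqF ?sqrtr_gt0//.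
  by case: (size_jacobi m al_gt be1).
have [psiL psiO] := psi_orthonormal al_gt.
have cpsi i : continuous (psi al i) by exact: psi_continuous.
have [] := @half_range_substitution _
  (fun t => (p m).[t] * (p n).[t] * jacobi_weight al be t)
  (fun x => psi al (k + m.*2) x * psi al (k + n.*2) x).
- move=> t tI; apply: cvgM; last exact: jacobi_weight_continuous.
  by apply: cvgM; exact: continuous_horner.
- by move=> x; apply: cvgM; exact: cpsi.
- by apply/Lfun1_integrable; apply: Lfun2_mul_Lfun1; exact: psiL.
- move=> x; rewrite !psiE hmapN !ThN.
  have := sqrr_sign R k; rewrite expr2 => e.
  by rewrite mulrACA [X in X * _]mulrACA e mul1r mulrACA.
- by move=> x x0; rewrite -[LHS]mulrA w_Th// !psiE; ring.
move=> iG eG; split=> //.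
by rewrite eG psiO eqn_add2l (inj_eq double_inj).
Qed.

Lemma psi_half_range_form : half_range_form (psi al).
Proof.
have half_gt : -1 < 2^-1 :> R.
  by apply: (lt_trans (ltrN10 _)); rewrite invr_gt0.
have Nhalf_gt : -1 < - 2^-1 :> R by rewrite ltrN2 invf_lt1// ltr1n.
have w_ThE x : 0 < x -> jacobi_weight al (- 2^-1) (hmap x) * dhmap x = 2 * ThE x ^+ 2.
  exact: jacobi_weight_even.
have w_ThO x : 0 < x -> jacobi_weight al 2^-1 (hmap x) * dhmap x = 2 * ThO x ^+ 2.
  by rewrite sqrrN; exact: jacobi_weight_odd.
have ThEN x : ThE (- x) = ThE x by rewrite /ThE gaugeN.
have ThON x : ThO (- x) = - ThO x by rewrite /ThO gaugeN tanhN mulNr mulrN.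
have ThE_neq0 x : 0 < x -> ThE x != 0 by rewrite gt_eqF.
have ThO_neq0 x : 0 < x -> ThO x != 0 by move=> x0; rewrite lt_eqF// ThO_lt0.
exists (jacobi_weight al (- 2^-1)), (jacobi_weight al 2^-1), rE, rO,
  hinv, hmap, (multiplier ThE), (multiplier ThO), ThE, ThO.
split.
- exact: is_density_jacobi_weight.
- exact: is_density_jacobi_weight.
- apply: (@jacobi_orthonormal _ ThE rE 0) => //.
  + by move=> m; exact: jacobi_sqnorm_even_gt0.
  + by move=> x; rewrite expr0 mul1r.
- apply: (@jacobi_orthonormal _ ThO rO 1) => //.
  + by move=> m; exact: jacobi_sqnorm_odd_gt0.
  + by move=> x; rewrite expr1 mulN1r.
- exact: hmap_half_range_change.
- apply: (@multiplier_bounded _ _ 1) => //; last by rewrite expr1n.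
  by move=> x x0; rewrite mul1r gtr0_norm.
- apply: (@multiplier_bounded _ _ (-1)) => //; last by rewrite sqrrN expr1n.
  by move=> x x0; rewrite mulN1r ltr0_norm ?ThO_lt0// opprK.
- exact: ThEN.
- exact: ThON.
- by move=> x x0; exact: multiplier_Theta.
- by move=> x x0; exact: multiplier_Theta.
- by rewrite gt_eqF.
- exact: psi_even_E.
- exact: psi_odd_E.
Qed.

Theorem psi_half_range_system : half_range_system (psi al).
Proof.
split; [exact: psi_half_range_form | exact: psi_orthonormal |].
exact: psi_tridiagonal.
Qed.

End PsiHalfRange.

End HalfRangeForm.

(** * The Riccati system behind a half-range system *)

Section RiccatiSystem.
Context {R : realType}.
Implicit Types x t v : R.

Lemma derive_ge0_le (f df : R -> R) a : (forall x, is_derive x (1 : R) f (df x)) ->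
  (forall x, a < x -> 0 <= df x) -> forall x y, a <= x -> x <= y -> f x <= f y.
Proof.
move=> fd df0 x y ax xy; apply: (@ger0_derive1_ndecry _ f a) => //.
- move=> z; rewrite in_itv/= andbT => az.
  by rewrite derive1E (@derive_val _ _ _ _ _ _ _ (fd z)) df0.
- exact/continuous_subspaceT/(derive_continuous fd).
Qed.

Lemma pos_near0_ge_half (e W : R) (g : R -> R) : 0 <= W ->
    (forall v, 0 < v < 1 -> 0 < e + g v) ->
    (forall v, 0 < v < 1 -> `|g v| <= W * v) -> e != 0 ->
    0 < e /\ exists d, [/\ 0 < d, d <= 1 &
       forall v, 0 < v < d -> e / 2 <= e + g v].
Proof.
  move=> W0 epos gW en; have W1 : 0 < 2 * (W + 1) by lra.
  pose d := Num.min 1 (`|e| / (2 * (W + 1))).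
  have d0 : 0 < d by rewrite lt_min ltr01 divr_gt0// normr_gt0.
  have d1 : d <= 1 by rewrite ge_min lexx.
  have gd v : 0 < v < d -> `|g v| <= `|e| / 2.
    move=> /andP[v0 vd]; have v1 : v < 1 by apply: lt_le_trans d1.
    have : v < `|e| / (2 * (W + 1)) by apply: lt_le_trans vd _; rewrite ge_min lexx orbT.
    rewrite ltr_pdivlMr// => vW; have := gW v; rewrite v0 v1 => /(_ isT); nra.
  have e0 : 0 < e.
    rewrite lt_neqAle eq_sym en leNgt /=; apply/negP => en0.
    have vI : 0 < d / 2 < d by apply/andP; split; lra.
    have := gd _ vI; have := epos (d / 2); rewrite (ltr0_norm en0) ler_norml.
    have -> : 0 < d / 2 < 1 by apply/andP; split; lra.
    by move=> /(_ isT) ? /andP[_ ?]; lra.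
  split=> //; exists d; split=> // v /gd; rewrite (gtr0_norm e0) ler_norml.
  by move=> /andP[? _]; lra.
Qed.

(** The first nonzero coefficient among [k0], [k1] must be positive and
    dominates near 0. *)
Lemma quadratic_ge_linear (k0 k1 k2 : R) :
  (forall v, 0 < v < 1 -> 0 < k0 + k1 * v + k2 * v ^+ 2) ->
  (k0, k1) <> (0, 0) ->
  exists c d : R, [/\ 0 < c, 0 < d, d <= 1 &
    forall v, 0 < v < d -> c * v <= k0 + k1 * v + k2 * v ^+ 2].
Proof.
move=> pos k01.
have [k00|k0n] := eqVneq k0 0.
  have k1n : k1 != 0 by apply/eqP => k10; apply: k01; rewrite k00 k10.
  have [||k1_gt0 [d [d0 d1 kd]]] :=
    @pos_near0_ge_half k1 `|k2| (fun v => k2 * v) (normr_ge0 _) _ _ k1n.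
  - move=> v vI; have := pos v vI; rewrite k00 add0r => h.
    have v0 : 0 < v by case/andP: vI.
    by rewrite -(pmulr_rgt0 _ v0); move: h; congr (_ < _); ring.
  - by move=> v /andP[v0 _]; rewrite normrM (gtr0_norm v0).
  exists (k1 / 2), d; split=> //; first by rewrite divr_gt0.
  move=> v vI; have := kd v vI; have v0 : 0 < v by case/andP: vI.
  rewrite -(ler_pM2r v0) k00 => h; apply: (le_trans h).
  by rewrite le_eqVlt; apply/orP; left; apply/eqP; ring.
have [||k0_gt0 [d [d0 d1 kd]]] :=
  @pos_near0_ge_half k0 (`|k1| + `|k2|) (fun v => k1 * v + k2 * v ^+ 2)
    (addr_ge0 (normr_ge0 _) (normr_ge0 _)) _ _ k0n.
- by move=> v vI; rewrite addrA; exact: pos.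
- move=> v /andP[v0 v1]; apply: (le_trans (ler_normD _ _)); rewrite !normrM mulrDl.
  rewrite (gtr0_norm v0) lerD2l ler_wpM2l// ler_piMr ?ltW//.
exists (k0 / 2), d; split=> //; first by rewrite divr_gt0.
move=> v vI; have := kd v vI; rewrite addrA; apply: le_trans.
case/andP: vI => v0 vd; rewrite ler_piMr ?divr_ge0 ?ltW//.
exact: lt_le_trans d1.
Qed.

Variables (u H : R -> R) (b C D A B q0 q1 q2 : R).
Hypothesis du : forall x, is_derive x (1 : R) u (C + D * H x - b * u x ^+ 2).
Hypothesis dH : forall x, is_derive x (1 : R) H (u x * (A + B * H x)).
Hypothesis uQ : forall x, u x ^+ 2 * (A + B * H x) = q0 + q1 * H x + q2 * H x ^+ 2.
Hypotheses (u0 : u 0 = 0) (H0 : H 0 = -1).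
Hypothesis H_lt1 : forall x, H x < 1.
Hypothesis H_onto : forall t, -1 < t < 1 -> exists2 x, 0 < x & H x = t.
Hypothesis dH_gt0 : forall x, 0 < x -> 0 < u x * (A + B * H x).

Let M t := (q0 + q2 * t) * (A + B * t).

(* At x = 0 the relation uQ reads 0 = q0 - q1 + q2, so the quadratic on its right
   side has the factor 1 + H. *)
Let q1E : q1 = q0 + q2.
Proof. have := uQ 0; rewrite u0 H0 expr0n/= mul0r => h; lra. Qed.

Let dH_sqr x : (u x * (A + B * H x)) ^+ 2 = (1 + H x) * M (H x).
Proof.
rewrite exprMn [(A + _) ^+ 2]expr2 mulrA uQ q1E /M; ring.
Qed.

Let M_gt0 t : -1 < t < 1 -> 0 < M t.
Proof.
move=> tI; have [x x0 Hx] := H_onto tI.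
have := exprn_gt0 2 (dH_gt0 x0); rewrite dH_sqr Hx pmulr_rgt0//.
by case/andP: tI => t1 _; lra.
Qed.

(* Otherwise M (1 - v) >= c v near v = 0, hence H' >= sqrt (c (1 - H)) once H is
   close to 1; then sqrt (1 - H) decreases at least linearly and H reaches the
   value 1 in finite time. *)
Let M_double_root : (q0 + q2) * (A + B) = 0 /\ q2 * (A + B) + B * (q0 + q2) = 0.
Proof.
pose k0 := (q0 + q2) * (A + B); pose k1 := - (q2 * (A + B) + B * (q0 + q2)).
have ME v : M (1 - v) = k0 + k1 * v + (q2 * B) * v ^+ 2.
  by rewrite /M /k0 /k1; ring.
suff k01 : (k0, k1) = (0, 0).
  by case: k01 => h0 h1; split=> //; rewrite -[LHS]opprK -/k1 h1 oppr0.
apply/not_notP => k01.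
have [|c [d [c0 d0 d1 cM]]] := @quadratic_ge_linear k0 k1 (q2 * B) _ k01.
  by move=> v /andP[v0 v1]; rewrite -ME; apply: M_gt0; apply/andP; split; lra.
have [x1 x1_gt0 Hx1] : exists2 x, 0 < x & H x = 1 - d / 2.
  by apply: H_onto; apply/andP; split; lra.
have H_ge x : x1 <= x -> 1 - d / 2 <= H x.
  move=> x1x; rewrite -Hx1; apply: (derive_ge0_le dH (a := x1)) => // z x1z.
  by rewrite ltW// dH_gt0// (lt_trans x1_gt0).
pose s x := Num.sqrt (1 - H x).
have s_gt0 x : 0 < s x by rewrite sqrtr_gt0 subr_gt0.
have s2 x : s x ^+ 2 = 1 - H x by rewrite sqr_sqrtr// subr_ge0 ltW.
have ds x : is_derive x (1 : R) s (- (u x * (A + B * H x)) / (2 * s x)).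
  have dHx := dH x.
  have d1H : is_derive x (1 : R) (fun y => 1 - H y) (- (u x * (A + B * H x))).
    by apply: is_derive_eq; ring.
  have p1 : 0 < 1 - H x by rewrite subr_gt0.
  apply: (is_derive_eq (is_derive1_comp (g := fun y => 1 - H y) (is_derive1_sqrt p1) d1H)).
  by rewrite mulrC.
have speed x : x1 < x -> Num.sqrt c / 2 <= u x * (A + B * H x) / (2 * s x).
  move=> x1x.
  have px : 0 < u x * (A + B * H x) by rewrite dH_gt0// (lt_trans x1_gt0).
  rewrite ler_pdivlMr ?mulr_gt0// (_ : _ * (2 * s x) = Num.sqrt c * s x); last by field.
  rewrite -(@ler_pXn2r _ 2)// ?nnegrE ?(ltW px) ?(mulr_ge0 (sqrtr_ge0 _) (ltW (s_gt0 _)))//.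
  rewrite exprMn sqr_sqrtr ?(ltW c0)// s2 dH_sqr.
  have HI : 0 < 1 - H x < d.
    by have := H_ge x (ltW x1x); have := H_lt1 x => h1 h2; apply/andP; split; lra.
  have := cM _ HI; rewrite -ME subKr => h.
  have Mp : 0 < M (H x) by apply: M_gt0; case/andP: HI => *; apply/andP; split; lra.
  apply: (le_trans h); rewrite ler_peMl ?(ltW Mp)//; case/andP: HI => *; lra.
pose x2 := x1 + 2 * s x1 / (Num.sqrt c / 2).
have c20 : 0 < Num.sqrt c / 2 by rewrite divr_gt0// sqrtr_gt0.
have dx2 : 0 < 2 * s x1 / (Num.sqrt c / 2) by rewrite divr_gt0// mulr_gt0.
have := s_gt0 x1; have := s_gt0 x2.
have x2E : (Num.sqrt c / 2) * x2 = (Num.sqrt c / 2) * x1 + 2 * s x1.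
  by rewrite /x2 mulrDr; congr (_ + _); rewrite mulrC divfK// gt_eqF.
move=> s2_gt0 s1_gt0.
have : - s x1 - Num.sqrt c / 2 * x1 <= - s x2 - Num.sqrt c / 2 * x2.
  apply: (@derive_ge0_le (fun x => - s x - (Num.sqrt c / 2) * x)
    (fun x => u x * (A + B * H x) / (2 * s x) - (Num.sqrt c / 2)) x1) => //.
  - move=> x; have dsx := ds x.
    by apply: is_derive_eq; rewrite /GRing.scale/=; ring.
  - by move=> x x1x; rewrite subr_ge0 speed.
  - by rewrite /x2 lerDl ltW.
rewrite x2E; lra.
Qed.

(** A double root of [M t = (q0 + q2 t) (A + B t)] at 1 can only be shared
    equally by the two factors, as neither vanishes identically.  This gives the
    equations for [u^2] and [H'].  Differentiating [u^2 = kap (1 + H)] for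
    positive arguments gives an affine identity in [H]; two values of [H]
    determine its coefficients, whence the equation for [u'] everywhere. *)
Lemma riccati_normal_form : exists l kap : R, [/\ 0 < kap, l != 0,
  forall x, u x ^+ 2 = kap * (1 + H x),
  forall x, u x * (A + B * H x) = l * u x * (1 - H x) &
  forall x, C + D * H x - b * u x ^+ 2 = l * kap - l / 2 * u x ^+ 2].
Proof.
have [M1 M2] := M_double_root.
have M0 : 0 < q0 * A.
  by rewrite (_ : q0 * A = M 0) ?M_gt0 ?/M ?ltr01 ?oppr_lt0 ?ltr01//; ring.
have BA : B = - A.
  move/eqP: M1; rewrite mulf_eq0 => /orP[/eqP q02|/eqP AB]; last by lra.
  move: M2; rewrite q02 mulr0 addr0 => /eqP; rewrite mulf_eq0 => /orP[/eqP q2_0|/eqP]; last lra.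
  by move: q02 M0; rewrite q2_0 addr0 => ->; rewrite mul0r ltxx.
have A0 : A != 0 by apply: contraTneq M0 => ->; rewrite mulr0 ltxx.
have q2E : q2 = - q0.
  move: M2; rewrite BA subrr mulr0 add0r mulNr => /eqP.
  by rewrite oppr_eq0 mulf_eq0 (negPf A0)/= => /eqP; lra.
have kap0 : 0 < q0 / A.
  by rewrite -(pmulr_lgt0 _ (_ : 0 < A ^+ 2)) ?exprn_even_gt0// expr2 mulrA divfK.
have uH x : u x ^+ 2 = q0 / A * (1 + H x).
  have H1 : 1 - H x != 0 by rewrite gt_eqF// subr_gt0.
  apply: (mulIf (mulf_neq0 A0 H1)).
  rewrite (_ : A * (1 - H x) = A + B * H x); last by rewrite BA; ring.
  by rewrite uQ q1E q2E BA; field.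
exists A, (q0 / A); split=> //; first by move=> x; rewrite BA; ring.
set kap := q0 / A in kap0 uH *.
have ODE x : 0 < x -> 2 * (C + D * H x - b * (kap * (1 + H x))) = kap * (A * (1 - H x)).
  move=> x0.
  have ux : u x != 0 by apply: contraTneq (dH_gt0 x0) => ->; rewrite mul0r ltxx.
  have dux := du x; have dHx := dH x.
  have d1 : is_derive x (1 : R) (fun y => u y ^+ 2) (2 * u x * (C + D * H x - b * u x ^+ 2)).
    by apply: is_derive_eq; rewrite /GRing.scale/=; ring.
  have d2 : is_derive x (1 : R) (fun y => kap * (1 + H y)) (kap * (u x * (A + B * H x))).
    by apply: is_derive_eq; rewrite /GRing.scale/=; ring.
  rewrite (_ : (fun y => u y ^+ 2) = (fun y => kap * (1 + H y))) in d1; last exact/funext.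
  have := @derive_val _ _ _ _ _ _ _ d1.
  rewrite (@derive_val _ _ _ _ _ _ _ d2) uH BA => e.
  apply: (mulfI ux); rewrite [RHS](_ : _ = kap * (u x * (A + - A * H x))); last by ring.
  by rewrite e; ring.
have half0 : -1 < (0 : R) < 1 by rewrite oppr_lt0 ltr01.
have half1 : -1 < (1 / 2 : R) < 1 by apply/andP; split; lra.
have [x1 x1_gt0 Hx1] := H_onto half0; have [x2 x2_gt0 Hx2] := H_onto half1.
have := ODE _ x1_gt0; have := ODE _ x2_gt0; rewrite Hx1 Hx2 => o2 o1 x.
have CE : C = b * kap + kap * A / 2 by lra.
have DE : D = b * kap - kap * A / 2 by lra.
by rewrite uH CE DE; field.
Qed.

End RiccatiSystem.

(** * Explicit solutions *)

Section Explicit.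
Context {R : realType}.
Local Notation mu := (@lebesgue_measure R).
Implicit Types x t v : R.

Lemma is_derive_exp_scale a x :
  is_derive x (1 : R) (fun y => expR (a * y)) (a * expR (a * x)).
Proof. by apply: is_derive_eq; rewrite /GRing.scale/=; ring. Qed.

Lemma linear_ode (f : R -> R) (a : R) :
  (forall x, is_derive x (1 : R) f (a * f x)) -> forall x, f x = f 0 * expR (a * x).
Proof.
move=> df x.
have dg y : is_derive y (1 : R) (fun z => f z * expR (- a * z)) 0.
  have d1 := df y; have d2 := is_derive_exp_scale (- a) y.
  by apply: is_derive_eq; rewrite /GRing.scale/=; ring.
have := is_derive_0_is_cst x 0 dg; rewrite mulr0 expR0 mulr1 => <-.
by rewrite -mulrA -expRD mulNr addNr expR0 mulr1.
Qed.

(** The function [y = (1 - H)^(-1/2)] satisfies [y' = (l / 2) u y] and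
    [y'' = a^2 y], so that [y' + a y] and [y' - a y] are exponentials, and
    [y' / y] is [a tanh (a x)]. *)
Lemma riccati_explicit (u H : R -> R) (l kap : R) : 0 < kap -> l != 0 ->
  (forall x, is_derive x (1 : R) H (l * u x * (1 - H x))) ->
  (forall x, is_derive x (1 : R) u (l * kap - l / 2 * u x ^+ 2)) ->
  u 0 = 0 -> H 0 = -1 -> (forall x, H x < 1) ->
  let a := `|l| * Num.sqrt (kap / 2) in
  0 < a /\ forall x, l * u x = 2 * a * tanh (a * x).
Proof.
move=> kap0 l0 dH du u0 H0 H1 a.
have a0 : 0 < a by rewrite mulr_gt0 ?normr_gt0// sqrtr_gt0 divr_gt0.
have a2 : a ^+ 2 = l ^+ 2 * kap / 2.
  by rewrite exprMn real_normK ?num_real// sqr_sqrtr ?mulrA// ltW// divr_gt0.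
split=> //.
pose y x := (Num.sqrt (1 - H x))^-1.
have s0 x : 0 < Num.sqrt (1 - H x) by rewrite sqrtr_gt0 subr_gt0.
have y0 x : 0 < y x by rewrite invr_gt0.
have dy x : is_derive x (1 : R) y (l / 2 * u x * y x).
  have dHx := dH x.
  have d1H : is_derive x (1 : R) (fun y => 1 - H y) (- (l * u x * (1 - H x))).
    by apply: is_derive_eq; ring.
  have p1 : 0 < 1 - H x by rewrite subr_gt0.
  have ds := is_derive1_comp (g := fun y => 1 - H y) (is_derive1_sqrt p1) d1H.
  have sn : (@Num.sqrt R \o (fun y => 1 - H y)) x != 0 by rewrite gt_eqF/=.
  apply: (is_derive_eq (is_deriveV sn ds)).
  rewrite /y /GRing.scale/= -[X in l * u x * X](@sqr_sqrtr _ (1 - H x)) ?(ltW p1)//.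
  by field; rewrite gt_eqF.
have dw (c : R) x : c ^+ 2 = a ^+ 2 ->
    is_derive x (1 : R) (fun z => (l / 2 * u z + c) * y z) (c * ((l / 2 * u x + c) * y x)).
  move=> c2; have dyx := dy x; have dux := du x.
  apply: is_derive_eq; rewrite /GRing.scale/=.
  transitivity ((l ^+ 2 * kap / 2 + l / 2 * u x * c) * y x); first by field.
  by rewrite -a2 -c2; ring.
move=> x.
have := linear_ode (fun z => dw a z erefl) x.
have := linear_ode (fun z => dw (- a) z (sqrrN a)) x.
rewrite u0 mulr0 !add0r; have := y0 x; have := y0 0.
set y1 := y x; set y_0 := y 0; set T := l / 2 * u x => y_0p y1p e2 e1.
have yE : y1 = y_0 * cosh (a * x).
  have : 2 * a * y1 = 2 * a * (y_0 * cosh (a * x)).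
    rewrite /cosh -mulNr; move: e1 e2; rewrite !mulrDl; lra.
  by apply: mulfI; rewrite mulf_neq0// gt_eqF.
have TE : T * y1 = a * y_0 * sinh (a * x).
  by rewrite /sinh -mulNr; move: e1 e2; rewrite !mulrDl; lra.
have -> : l * u x = 2 * T by rewrite /T; field.
rewrite -mulrA; congr (2 * _); apply: (mulIf (lt0r_neq0 y1p)).
rewrite TE yE /tanh; field; exact: cosh_neq0.
Qed.

Lemma gaugeNp (q x : R) : gauge (- q) x = (gauge q x)^-1.
Proof. by rewrite !gaugeE opprK -expRN mulNr opprK. Qed.

Lemma log_derive_tanh (f : R -> R) (q a : R) :
  (forall x, is_derive x (1 : R) f (- q * a * tanh (a * x) * f x)) ->
  forall x, f x = f 0 * gauge q (a * x).
Proof.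
move=> df x.
have dg y : is_derive y (1 : R) (fun z => f z * gauge (- q) (a * z)) 0.
  have d1 := df y.
  have da : is_derive y (1 : R) (fun z => a * z) a.
    by apply: is_derive_eq; rewrite /GRing.scale/=; ring.
  have d2 := is_derive1_comp (g := fun z => a * z) (is_derive_gauge (- q) (a * y)) da.
  apply: (is_derive_eq (is_deriveM d1 d2)).
  by rewrite /GRing.scale/=; ring.
have := is_derive_0_is_cst x 0 dg; rewrite mulr0 gauge0 mulr1 => <-.
by rewrite gaugeNp divfK// gt_eqF// gauge_gt0.
Qed.

Lemma Rintegral_ge_cst_line (f : R -> R) (c : R) : 0 < c -> (forall x, c <= f x) ->
  measurable_fun [set: R] f -> \int[mu]_x f x = 0.
Proof.
move=> c0 cf mf; rewrite /Rintegral.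
suff -> : (\int[mu]_x (f x)%:E = +oo)%E by [].
apply/eqP; rewrite -leye_eq.
have e : (\int[mu]_(x in [set: R]) (c%:E) = +oo)%E.
  rewrite integral_cst//.
  have mT : mu [set: R] = +oo%E by rewrite -set_itvNyy lebesgue_measure_itv.
  by rewrite [X in (_ * X)%E]mT gt0_muley// lte_fin.
rewrite -[X in (X <= _)%E]e; apply: ge0_le_integral => //.
- by move=> x _; rewrite lee_fin ltW.
- exact/measurable_EFinP.
- by move=> x _; rewrite lee_fin.
Qed.

End Explicit.

(** * The first function of a half-range system *)

Section FirstFunction.
Context {R : realType}.
Implicit Types x t v : R.

Lemma horner_size1 (p : {poly R}) y : size p = 1%N -> p.[y] = p`_0.
Proof. by move=> sp; rewrite horner_coef sp big_ord_recl big_ord0 addr0 mulr1. Qed.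

Lemma horner_size2 (p : {poly R}) y : size p = 2%N -> p.[y] = p`_0 + p`_1 * y.
Proof. by move=> sp; rewrite horner_coef sp !big_ord_recl big_ord0/= addr0 mulr1. Qed.

Lemma horner_size3 (p : {poly R}) y : size p = 3%N ->
  p.[y] = p`_0 + p`_1 * y + p`_2 * y ^+ 2.
Proof.
by move=> sp; rewrite horner_coef sp !big_ord_recl big_ord0/= addr0 mulr1 addrA.
Qed.

Lemma coef_size_neq0 (p : {poly R}) n : size p = n.+1 -> p`_n != 0.
Proof.
move=> sp; have := lead_coef_eq0 p; rewrite lead_coefE sp /= => ->.
by rewrite -size_poly_eq0 sp.
Qed.

Lemma is_derive_unique (f : R -> R) x (d1 d2 : R) :
  is_derive x (1 : R) f d1 -> is_derive x (1 : R) f d2 -> d1 = d2.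
Proof.
by move=> h1 h2; rewrite -(@derive_val _ _ _ _ _ _ _ h1) (@derive_val _ _ _ _ _ _ _ h2).
Qed.

(** Gronwall: [(f^2 + g^2) exp (N x)] is nondecreasing when [N] bounds
    [`|b + V|]. *)
Lemma linear_system_zero_free (f g V : R -> R) (b K : R) x0 :
  (forall x, is_derive x (1 : R) f (b * g x)) ->
  (forall x, is_derive x (1 : R) g (f x * V x)) ->
  (forall x, `|V x| <= K) -> f 0 != 0 -> 0 <= x0 ->
  ~ (f x0 = 0 /\ g x0 = 0).
Proof.
move=> df dg VK f0 x00 [fx gx]; pose N := `|b| + K.
pose E x := (f x ^+ 2 + g x ^+ 2) * expR (N * x).
have dE x : is_derive x (1 : R) E
   ((2 * f x * g x * (b + V x) + N * (f x ^+ 2 + g x ^+ 2)) * expR (N * x)).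
  have dfx := df x; have dgx := dg x; have dex := is_derive_exp_scale N x.
  by apply: is_derive_eq; rewrite /GRing.scale/=; ring.
have dE0 x : 0 < x ->
    0 <= (2 * f x * g x * (b + V x) + N * (f x ^+ 2 + g x ^+ 2)) * expR (N * x).
  move=> _; rewrite mulr_ge0 ?expR_ge0//.
  have bV : `|b + V x| <= N by rewrite (le_trans (ler_normD _ _))// lerD2l.
  have fg : `|2 * f x * g x| <= f x ^+ 2 + g x ^+ 2.
    have h1 := sqr_ge0 (f x - g x); have h2 := sqr_ge0 (f x + g x).
    by rewrite ler_norml; apply/andP; split; nra.
  have : `|2 * f x * g x * (b + V x)| <= N * (f x ^+ 2 + g x ^+ 2).
    by rewrite normrM mulrC ler_pM.
  by rewrite ler_norml => /andP[h _]; rewrite -lerBlDr sub0r.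
have := derive_ge0_le dE dE0 (lexx 0) x00.
rewrite /E fx gx expr0n/= addr0 mul0r mulr0 expR0 mulr1 => h.
have := exprn_even_gt0 (n := 2) (f 0) isT; rewrite f0 orbT => h1.
by have := sqr_ge0 (g 0); lra.
Qed.

(** The quotients [phi 2 / phi 0], [phi 4 / phi 0] and [phi 3 / phi 1] are
    polynomials in [H], so the first four derivative relations close up into a
    first order system for [phi 0], [phi 1] and [H]. *)
Lemma half_range_first_function (phi : nat -> R -> R) :
  half_range_form phi -> tridiagonal_skew_differentiation phi ->
  exists q a : R, [/\ 0 < a, phi 0%N 0 != 0 &
    forall x, phi 0%N x = phi 0%N 0 * gauge q (a * x)].
Proof.
move=> [wE [wO [r [s [h [H [thE [thO [ThE [ThO data]]]]]]]]]] [b [b_gt0 dphi]].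
have [sr _] := hr_polyE data; have [ss _] := hr_polyO data.
have HC := hr_change data.
set f := phi 0%N; set g := phi 1%N.
have r00 := coef_size_neq0 (sr 0%N); have r11 := coef_size_neq0 (sr 1%N).
have s00 := coef_size_neq0 (ss 0%N); have s11 := coef_size_neq0 (ss 1%N).
have fE x : f x = ThE x * (r 0%N)`_0.
  by rewrite /f (hr_phi_even data 0%N) horner_size1.
have gE x : g x = ThO x * (s 0%N)`_0.
  by rewrite /g (hr_phi_odd data 0%N) horner_size1.
pose rho0 := (r 1%N)`_0 / (r 0%N)`_0; pose rho1 := (r 1%N)`_1 / (r 0%N)`_0.
pose sig0 := (s 1%N)`_0 / (s 0%N)`_0; pose sig1 := (s 1%N)`_1 / (s 0%N)`_0.
pose k0 := (r 2%N)`_0 / (r 0%N)`_0; pose k1 := (r 2%N)`_1 / (r 0%N)`_0.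
pose k2 := (r 2%N)`_2 / (r 0%N)`_0.
have rho1_neq0 : rho1 != 0 by rewrite mulf_neq0// invr_eq0.
have sig1_neq0 : sig1 != 0 by rewrite mulf_neq0// invr_eq0.
have phi2E x : phi 2%N x = f x * (rho0 + rho1 * H x).
  by rewrite (hr_phi_even data 1%N) horner_size2// fE /rho0 /rho1; field.
have phi3E x : phi 3%N x = g x * (sig0 + sig1 * H x).
  by rewrite (hr_phi_odd data 1%N) horner_size2// gE /sig0 /sig1; field.
have phi4E x : phi 4%N x = f x * (k0 + k1 * H x + k2 * H x ^+ 2).
  by rewrite (hr_phi_even data 2%N) horner_size3// fE /k0 /k1 /k2; field.
pose C := b 1%N * rho0 - b 0%N; pose D := b 1%N * rho1.
have df x : is_derive x (1 : R) f (b 0%N * g x).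
  by apply: (is_derive_eq (dphi 0%N x)); rewrite subr0.
have dg x : is_derive x (1 : R) g (f x * (C + D * H x)).
  by apply: (is_derive_eq (dphi 1%N x)); rewrite -/f phi2E /C /D; ring.
pose A := (- b 1%N + b 2%N * sig0 - b 0%N * rho0) / rho1.
pose B := (b 2%N * sig1 - b 0%N * rho1) / rho1.
pose q0 := (- b 2%N * rho0 + b 3%N * k0 - C * sig0) / sig1.
pose q1 := (- b 2%N * rho1 + b 3%N * k1 - C * sig1 - D * sig0) / sig1.
pose q2 := (b 3%N * k2 - D * sig1) / sig1.
have rel x : derivable H x 1 ->
    f x * derive1 H x = g x * (A + B * H x) /\
    g x * derive1 H x = f x * (q0 + q1 * H x + q2 * H x ^+ 2).
  move=> /derivableP; rewrite -derive1E => dHx.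
  have dfx := df x; have dgx := dg x; split.
    have d2 : is_derive x (1 : R) (phi 2%N)
        (b 0%N * g x * (rho0 + rho1 * H x) + f x * rho1 * derive1 H x).
      rewrite (_ : phi 2%N = (fun y => f y * (rho0 + rho1 * H y))); last exact/funext.
      by apply: is_derive_eq; rewrite /GRing.scale/=; ring.
    have := is_derive_unique d2 (dphi 2%N x); rewrite phi3E -/f -/g => e.
    apply: (mulIf rho1_neq0); rewrite [LHS](_ : _ = f x * rho1 * derive1 H x); last by ring.
    rewrite -[LHS](addrK (b 0%N * g x * (rho0 + rho1 * H x))).
    rewrite [X in X - _]addrC e /A /B; field; exact: rho1_neq0.
  have d3 : is_derive x (1 : R) (phi 3%N)
      (f x * (C + D * H x) * (sig0 + sig1 * H x) + g x * sig1 * derive1 H x).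
    rewrite (_ : phi 3%N = (fun y => g y * (sig0 + sig1 * H y))); last exact/funext.
    by apply: is_derive_eq; rewrite /GRing.scale/=; ring.
  have := is_derive_unique d3 (dphi 3%N x); rewrite phi4E phi2E -/f -/g => e.
  apply: (mulIf sig1_neq0); rewrite [LHS](_ : _ = g x * sig1 * derive1 H x); last by ring.
  rewrite -[LHS](addrK (f x * (C + D * H x) * (sig0 + sig1 * H x))).
  rewrite [X in X - _]addrC e /q0 /q1 /q2; field; exact: sig1_neq0.
have Hpos x : 0 < x -> -1 < H x < 1 /\ 0 < derive1 H x.
  move=> x0; have : x \in (`]0, +oo[%classic : set R) by rewrite inE/= in_itv/= andbT.
  rewrite -(hrc_onto HC) inE => -[t tI <-].
  rewrite (hrc_HK HC) ?inE//; split; first by move: tI; rewrite /= in_itv.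
  rewrite -(pmulr_rgt0 _ (hrc_gt0 HC (mem_set tI))).
  by rewrite (hrc_derive HC (mem_set tI)) ltr01.
have H0 := hrc_0 HC.
have H_onto t : -1 < t < 1 -> exists2 x, 0 < x & H x = t.
  move=> tI; have tI' : t \in (`]-1, 1[%classic : set R) by rewrite inE/= in_itv.
  exists (h t); last exact: (hrc_HK HC tI').
  have : (h @` (`]-1, 1[%classic : set R)) (h t) by exists t => //; exact: set_mem.
  by rewrite (hrc_onto HC)/= in_itv/= andbT.
have HN := hrc_even HC.
have H_lt1 x : H x < 1.
  have [x0|x0|<-] := ltgtP 0 x; last by rewrite H0; lra.
    by have [/andP[]] := Hpos x x0.
  by rewrite -HN; have [|/andP[]] := Hpos (- x); rewrite ?oppr_gt0.
have H_geN1 x : -1 <= H x.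
  have [x0|x0|<-] := ltgtP 0 x; last by rewrite H0.
    by have [/andP[/ltW]] := Hpos x x0.
  by rewrite -HN; have [|/andP[/ltW]] := Hpos (- x); rewrite ?oppr_gt0.
have f0 : f 0 != 0 by rewrite fE mulf_neq0// (hr_ThetaE0 data).
have f_neq0 x : f x != 0.
  have fpos y : 0 <= y -> f y != 0.
    rewrite le_eqVlt => /predU1P[<-//|y0]; apply/eqP => fy.
    have [_ dHy] := Hpos y y0.
    have [_ gdH] := rel y (hrc_Hderivable HC y0).
    have gy : g y = 0 by move/eqP: gdH; rewrite fy mul0r mulf_eq0 (gt_eqF dHy) orbF => /eqP.
    apply: (linear_system_zero_free (K := `|C| + `|D|) df dg _ f0 (ltW y0)) => // z.
    rewrite (le_trans (ler_normD _ _))// lerD2l normrM ler_piMr// ler_norml.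
    by rewrite H_geN1 ltW.
  have [x0|x0] := leP 0 x; first exact: fpos.
  rewrite fE -(hr_evenE data) -fE; apply: fpos; rewrite oppr_ge0; exact: ltW.
pose u x := g x / f x.
have dH x : derivable H x 1.
  have dfx := df x.
  have dV : is_derive x (1 : R) (fun y => (f y)^-1) _ := is_deriveV (f_neq0 x) dfx.
  have d2 : is_derive x (1 : R) (fun y => phi 2%N y * (f y)^-1) _ :=
    is_deriveM (dphi 2%N x) dV.
  have HE : H = (fun y => rho1^-1 * (phi 2%N y * (f y)^-1 - rho0)).
    by apply/funext => y; rewrite phi2E; field; rewrite rho1_neq0 f_neq0.
  rewrite HE; exact: (@ex_derive _ _ _ _ _ _ _ _).
have dHE x : derive1 H x = u x * (A + B * H x).
  have [e _] := rel x (dH x); apply: (mulfI (f_neq0 x)); rewrite e /u; field; exact: f_neq0.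
have uQ x : u x ^+ 2 * (A + B * H x) = q0 + q1 * H x + q2 * H x ^+ 2.
  have [_ e] := rel x (dH x); apply: (mulfI (f_neq0 x)); rewrite -e dHE /u; field; exact: f_neq0.
have du x : is_derive x (1 : R) u (C + D * H x - b 0%N * u x ^+ 2).
  have dfx := df x.
  have dV : is_derive x (1 : R) (fun y => (f y)^-1) _ := is_deriveV (f_neq0 x) dfx.
  apply: (is_derive_eq (is_deriveM (dg x) dV)).
  rewrite /u /GRing.scale/=; field; exact: f_neq0.
have u0 : u 0 = 0.
  rewrite /u gE; have := hr_oddO data 0; rewrite oppr0 => e.
  by rewrite (_ : ThO 0 = 0) ?mul0r//; lra.
have dH' x : is_derive x (1 : R) H (u x * (A + B * H x)).
  by rewrite -dHE derive1E; exact/derivableP.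
have [x x0|l [kap [kap0 l0 _ uH uu]]] := riccati_normal_form du dH' uQ u0 H0 H_lt1 H_onto.
  by rewrite -dHE; case: (Hpos x x0).
have [|x|a0 ua] := riccati_explicit kap0 l0 _ _ u0 H0 H_lt1.
- by move=> x; rewrite -uH.
- by rewrite -uu.
exists (- (2 * b 0%N / l)), (`|l| * Num.sqrt (kap / 2)); split=> //.
apply: log_derive_tanh => x; apply: (is_derive_eq (df x)).
set a := _ * Num.sqrt _ in a0 ua *.
rewrite (_ : g x = u x * f x); last by rewrite /u divfK.
rewrite (_ : u x = 2 * a * tanh (a * x) / l); last by rewrite -ua; field.
by rewrite /u; field.
Qed.

End FirstFunction.

(** * Rigidity of tridiagonal orthonormal systems *)

Section Uniqueness.
Context {R : realType}.
Local Notation mu := (@lebesgue_measure R).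
Implicit Types x : R.

Definition normalised (phi : nat -> R -> R) : Prop := forall m,
  mu.-integrable [set: R] (EFin \o (fun x => phi m x ^+ 2)) /\
  \int[mu]_x (phi m x ^+ 2) = 1.

Lemma orthonormal_normalised phi : orthonormal_L2 phi -> normalised phi.
Proof.
move=> [L2 o] m; split; first exact: Lfun2_integrable_sqr.
by have := o m m; rewrite eqxx.
Qed.

Lemma normalised_colinear (f g : R -> R) (c : R) :
  mu.-integrable [set: R] (EFin \o (fun x => f x ^+ 2)) ->
  \int[mu]_x (f x ^+ 2) = 1 -> \int[mu]_x (g x ^+ 2) = 1 ->
  (forall x, g x = c * f x) -> c ^+ 2 = 1.
Proof.
move=> intf f1 g1 gE; rewrite -g1 -[LHS]mulr1 -[X in _ * X]f1 -RintegralZl//.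
by apply: eq_Rintegral => x _; rewrite gE exprMn.
Qed.

(** Inductively [b m phi_(m+1) = c m chi_(m+1)], and equality of the norms with
    [b m], [c m > 0] gives [b m = c m].  The induction carries
    [b k phi_k = c k chi_k] for the term of lower index. *)
Lemma tridiagonal_unique (phi chi : nat -> R -> R) :
  normalised phi -> normalised chi ->
  tridiagonal_skew_differentiation phi -> tridiagonal_skew_differentiation chi ->
  phi 0%N = chi 0%N -> phi =1 chi.
Proof.
move=> nphi nchi [b [b0 dphi]] [c [c0 dchi]] e0.
suff H m : phi m = chi m /\ (if m is k.+1 then b k *: phi k = c k *: chi k else True).
  by move=> m; case: (H m).
elim: m => [//|m [IHm IHk]].
have e x : b m * phi m.+1 x = c m * chi m.+1 x.
  have := dphi m x; rewrite IHm => d1; have := is_derive_unique d1 (dchi m x).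
  case: m IHm IHk {d1} => [|m] IHm IHk; first by rewrite !subr0.
  move/(congr1 (fun f : R -> R => f x)): IHk => /= IHk.
  have {}IHk : b m * phi m x = c m * chi m x := IHk.
  by rewrite IHk => /addIr.
have [intphi phi1] := nphi m.+1; have [_ chi1] := nchi m.+1.
have c1 : (b m / c m) ^+ 2 = 1.
  apply: (normalised_colinear intphi phi1 chi1) => x.
  by rewrite mulrAC e mulrAC divff ?mul1r// gt_eqF.
have cb : b m = c m.
  move/eqP: c1; rewrite sqrf_eq1 => /orP[/eqP h|/eqP h].
    by rewrite -[LHS](@divfK _ (c m)) ?gt_eqF// h mul1r.
  by have := divr_gt0 (b0 m) (c0 m); rewrite h ltr0N1.
split; last by rewrite cb IHm.
apply/funext => x; apply: (mulfI (lt0r_neq0 (b0 m))).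
by rewrite e cb.
Qed.

Lemma normalised_dilation (phi : nat -> R -> R) (k a : R) : 0 < a -> k ^+ 2 = a ->
  (forall m, continuous (phi m)) -> normalised phi ->
  normalised (fun m x => k * phi m (a * x)).
Proof.
move=> a0 ka cphi nphi m; have [intphi phi1] := nphi m.
have dA x : is_derive x (1 : R) (fun y => a * y) a.
  by apply: is_derive_eq; rewrite /GRing.scale/=; ring.
have dAE : derive1 (fun y => a * y) = cst a.
  by apply/funext => x; rewrite derive1E (@derive_val _ _ _ _ _ _ _ (dA x)).
have csq : continuous (fun y => phi m y ^+ 2).
  move=> y; apply: (@continuous_comp _ _ _ (phi m) (fun z => z ^+ 2)).
    exact: cphi.
  exact: exprn_continuous.
have e : (\int[mu]_x (phi m x ^+ 2)%:E = \int[mu]_x ((k * phi m (a * x)) ^+ 2)%:E)%E.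
  rewrite (@increasing_ge0_integration_by_substitutionT _ (fun y => a * y))//.
  - by apply: eq_integral => x _; rewrite dAE/= exprMn ka mulrC.
  - by move=> x y; rewrite ltr_pM2l.
  - by rewrite dAE => x; exact: cvg_cst.
  - by rewrite dAE; exact: is_cvg_cst.
  - by rewrite dAE; exact: is_cvg_cst.
  - exact: gt0_cvgMrNy.
  - exact: gt0_cvgMry.
  - by move=> x; exact: sqr_ge0.
split; last by rewrite /Rintegral -e.
apply/integrableP; split.
  apply/measurable_EFinP; apply: continuous_measurable_fun => x.
  have cA := derive_continuous dA.
  apply: (@continuous_comp _ _ _ (fun y => k * phi m (a * y)) (fun z => z ^+ 2)).
    apply: cvgM; first exact: cvg_cst.
    by apply: (@continuous_comp _ _ _ (fun y => a * y) (phi m)); [exact: cA | exact: cphi].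
  exact: exprn_continuous.
under eq_integral => x _ do rewrite /= ger0_norm ?sqr_ge0//.
rewrite -e; have /integrableP[_] := intphi.
by under eq_integral => x _ do rewrite /= ger0_norm ?sqr_ge0//.
Qed.

Lemma tridiagonal_dilation (phi : nat -> R -> R) (k a : R) : 0 < a ->
  tridiagonal_skew_differentiation phi ->
  tridiagonal_skew_differentiation (fun m x => k * phi m (a * x)).
Proof.
move=> a0 [b [b0 dphi]]; exists (fun m => a * b m); split=> [m|m x].
  by rewrite mulr_gt0.
have dA : is_derive x (1 : R) (fun y => a * y) a.
  by apply: is_derive_eq; rewrite /GRing.scale/=; ring.
have d := is_derive1_comp (g := fun y => a * y) (dphi m (a * x)) dA.
have d2 : is_derive x (1 : R) (fun y => phi m (a * y)) _ := d.
apply: is_derive_eq; rewrite /GRing.scale/=; case: m {d d2} => [|m]; ring.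
Qed.

End Uniqueness.

Theorem theorem3p1 (R : realType) :
  (forall phi : nat -> R -> R, half_range_system phi ->
     exists al a eps : R,
       [/\ -1 < al, 0 < a, eps = 1 \/ eps = -1 &
           forall (m : nat) (x : R),
             phi m x = eps * Num.sqrt a * psi al m (a * x)]) /\
  (forall al : R, -1 < al -> half_range_system (psi al)).
Proof.
split; last by move=> al; exact: psi_half_range_system.
move=> phi [form L2 tri].
have [q [a [a0 f0 phi0E]]] := half_range_first_function form tri.
have nphi := orthonormal_normalised L2; have [_ phi0_norm] := nphi 0%N.
have q0 : 0 < q.
  rewrite ltNge; apply/negP => q0.
  have g1 x : 1 <= gauge q x.
    rewrite gaugeE -expR0 ler_expR mulr_ge0 ?oppr_ge0//.
    rewrite -ln1 ler_ln ?posrE ?cosh_gt0//.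
    rewrite -(@ler_pXn2r _ 2)// ?nnegrE ?(ltW (cosh_gt0 _))//.
    by rewrite expr1n -[leLHS](cosh2_sinh2 x) lerBlDr lerDl sqr_ge0.
  have : \int[@lebesgue_measure R]_x (phi 0%N x ^+ 2) = 0.
    apply: (@Rintegral_ge_cst_line _ _ (phi 0%N 0 ^+ 2)).
    - by rewrite exprn_even_gt0.
    - move=> x; rewrite [in leRHS]phi0E exprMn ler_peMr ?sqr_ge0//.
      exact: exprn_ege1.
    - have [/integrableP[/measurable_EFinP]] := nphi 0%N; exact.
  by rewrite phi0_norm => /eqP; rewrite oner_eq0.
have al_gt : -1 < q - 1 by lra.
have psiL2 : orthonormal_L2 (psi (q - 1)) by exact: psi_orthonormal.
have psi_tri : tridiagonal_skew_differentiation (psi (q - 1)).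
  exact: psi_tridiagonal.
have npsi := orthonormal_normalised psiL2.
have cpsi m : continuous (psi (q - 1) m) by exact: psi_continuous.
have sqa : Num.sqrt a ^+ 2 = a by rewrite sqr_sqrtr// ltW.
have [k k0 psi0E] : exists2 k : R, k != 0 & forall x, psi (q - 1) 0%N x = k * gauge q x.
  exists (psi_poly (q - 1) 0%N)`_0.
    by apply: coef_size_neq0; exact: psi_poly_size.
  move=> x; rewrite psi_gauge horner_size1 ?psi_poly_size// mulrC.
  by congr (_ * gauge _ x); ring.
have s0 : Num.sqrt a != 0 by rewrite gt_eqF// sqrtr_gt0.
pose eps := phi 0%N 0 / (k * Num.sqrt a).
have phi0_psi x : phi 0%N x = eps * (Num.sqrt a * psi (q - 1) 0%N (a * x)).
  by rewrite phi0E psi0E /eps; field; rewrite s0 k0.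
have [int0 n0] := normalised_dilation a0 sqa cpsi npsi 0%N.
have eps2 := normalised_colinear int0 n0 phi0_norm phi0_psi.
exists (q - 1), a, eps; split=> //.
  by move/eqP: eps2; rewrite sqrf_eq1 => /orP[/eqP|/eqP] ->; [left|right].
have epsa : (eps * Num.sqrt a) ^+ 2 = a by rewrite exprMn eps2 mul1r.
have phiE : phi =1 (fun m x => eps * Num.sqrt a * psi (q - 1) m (a * x)).
  apply: tridiagonal_unique => //.
  - exact: (normalised_dilation a0 epsa cpsi npsi).
  - exact: (tridiagonal_dilation _ a0 psi_tri).
  - by apply/funext => y; rewrite phi0_psi mulrA.
by move=> m x; rewrite phiE.
Qed.
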